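(* Let $G$ be a finite group, $K\le G$, and $(\theta,V)$ an irreducible representation of $K$. Let $J$, $m_\sigma$, $W_\sigma$, $L_{\sigma,i}$, $U^\sigma_{i,j}$ and $\mathcal F$ be as defined in the context. (1) The set $$\left\{\sqrt{\frac{d_\theta|G/K|}{d_\sigma}}\,U^\sigma_{i,j}:\ \sigma\in J,\ i,j=1,2,\ldots,m_\sigma\right\}$$ is an orthonormal basis of $\mathrm{Hom}_G(\mathrm{Ind}_K^GV,\mathrm{Ind}_K^GV)$. In particular, the Fourier inversion formula is $$T=\sum_{\sigma\in J}\sum_{i,j=1}^{m_\sigma}[\mathcal FT(\sigma)]_{i,j}\,U^\sigma_{i,j}\qquad (T\in\mathrm{Hom}_G(\mathrm{Ind}_K^GV,\mathrm{Ind}_K^GV)).$$ (2) Setting $T_{\sigma,i}=\sqrt{\frac{d_\sigma}{d_\theta}}\,(L_{\sigma,i}^\diamond)^*$, we have the isometric orthogonal decomposition $$\mathrm{Ind}_K^GV=\bigoplus_{\sigma\in J}\bigoplus_{i=1}^{m_\sigma}T_{\sigma,i}W_\sigma$$ (each $T_{\sigma,i}:W_\sigma\to\mathrm{Ind}_K^GV$ is an isometric intertwining operator and the summands are mutually orthogonal), and the map $$\mathrm{Hom}_G(\mathrm{Ind}_K^GV,\mathrm{Ind}_K^GV)\longrightarrow\bigoplus_{\sigma\in J}M_{m_\sigma,m_\sigma}(\mathbb C),\qquad T\longmapsto\mathcal FT,$$ is an isomorphism of algebras. (3) The operator $U^\sigma_{i,j}$ intertwines the subspace $T_{\sigma,j}W_\sigma$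 with $T_{\sigma,i}W_\sigma$, i.e. it restricts to a $G$-equivariant isomorphism $T_{\sigma,j}W_\sigma\to T_{\sigma,i}W_\sigma$ (for all $\sigma\in J$, $1\le i,j\le m_\sigma$). (4) The operator $U^\sigma_{i,i}$ is the orthogonal projection of $\mathrm{Ind}_K^GV$ onto $T_{\sigma,i}W_\sigma$. (5) The irreducible characters of the algebra $\mathrm{Hom}_G(\mathrm{Ind}_K^GV,\mathrm{Ind}_K^GV)$ are the functions $\{\varphi^\sigma:\sigma\in J\}$ given by $$\varphi^\sigma(T)=\mathrm{tr}[\mathcal FT(\sigma)]\qquad\text{for every }T\in\mathrm{Hom}_G(\mathrm{Ind}_K^GV,\mathrm{Ind}_K^GV),$$ where $\varphi^\sigma$ is the character of the irreducible representation of the algebra on $\mathrm{Hom}_G(W_\sigma,\mathrm{Ind}_K^GV)$ given by $S\mapsto TS$.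
   Context: All vector spaces are finite-dimensional complex vector spaces with a Hermitian scalar product (linear in the first argument); all representations of finite groups are unitary; $d_\sigma$ denotes the dimension of a representation $\sigma$. $T^*$ denotes the adjoint of $T$. For spaces $A,B$, $\mathrm{Hom}(A,B)$ (and every subspace of it) carries the normalized Hilbert–Schmidt scalar product $\langle T_1,T_2\rangle=\frac{1}{\dim A}\mathrm{tr}(T_2^*T_1)$. $\mathrm{Hom}_G(A,B)$ (resp. $\mathrm{Hom}_K$) is the space of linear maps intertwining the $G$- (resp. $K$-) actions. $M_{m,m}(\mathbb C)$ is the algebra of complex $m\times m$ matrices. Induced representation: $\mathrm{Ind}_K^GV=\{f:G\to V: f(gk)=\theta(k^{-1})f(g)\ \forall g\in G,k\in K\}$ with $G$-action $[\lambda(g_0)f](g)=f(g_0^{-1}g)$ and scalar product $\langle f_1,f_2\rangle=\frac1{|K|}\sum_{g\in G}\langle f_1(g),f_2(g)\rangle_V$. For a $G$-representation $(\sigma,W)$ and $L\in\mathrm{Hom}_K(V,\mathrm{Res}^G_KW)$, $L^\diamond\in\mathrm{Hom}_G(\mathrm{Ind}_K^GV,W)$ is $L^\diamond f=\frac{1}{\sqrt{|G||K|}}\sum_{g\in G}\sigma(g)Lf(g)$. $\{(\sigma,W_\sigma):\sigma\in J\}$ is a complete set of pairwise inequivalent irreducible $G$-representations contained in $\mathrm{Ind}_K^GV$ and $m_\sigma$ is the multiplicity of $W_\sigma$ in $\mathrm{Ind}_K^GV$. For every $\sigma\in J$ an orthonormal basis $\{L_{\sigma,1},\ldots,L_{\sigma,m_\sigma}\}$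 of $\mathrm{Hom}_K(V,\mathrm{Res}^G_KW_\sigma)$ is fixed, and $U^\sigma_{i,j}=\frac{d_\sigma}{d_\theta}(L_{\sigma,i}^\diamond)^*L_{\sigma,j}^\diamond\in\mathrm{Hom}_G(\mathrm{Ind}_K^GV,\mathrm{Ind}_K^GV)$ for $i,j=1,\ldots,m_\sigma$. For $T\in\mathrm{Hom}_G(\mathrm{Ind}_K^GV,\mathrm{Ind}_K^GV)$ its Fourier transform at $\sigma\in J$ is the matrix $\mathcal FT(\sigma)\in M_{m_\sigma,m_\sigma}(\mathbb C)$ with entries $[\mathcal FT(\sigma)]_{i,j}=\frac{d_\theta|G/K|}{d_\sigma}\langle T,U^\sigma_{i,j}\rangle$, and $\mathcal FT=\bigoplus_{\sigma\in J}\mathcal FT(\sigma)$. The irreducible characters of a finite-dimensional algebra are the traces of its irreducible representations. *)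

(* Defs.v *)
From HB Require Import structures.
From mathcomp Require Import all_boot all_order all_fingroup all_algebra.
From mathcomp Require Import sesquilinear.

Set Implicit Arguments.
Unset Strict Implicit.
Unset Printing Implicit Defensive.

Import Order.TTheory GRing.Theory Num.Theory Num.Def.
Local Open Scope ring_scope.

(* A finite-dimensional Hermitian space; the library's {dot _ for conj} is
   linear in its first argument and conjugate-linear in the second. *)
Record hspace (C : numClosedFieldType) := HSpace {
  hs_vect :> vectType C;
  hs_form : {dot hs_vect for (@Num.conj C)}
}.

Notation "''[' u , v ]" := (hs_form _ u%R v%R) : ring_scope.
Definition hdim (C : numClosedFieldType) (V : hspace C) : C := (\dim {: V})%:R.

Section Operators.

Variable C : numClosedFieldType.

Lemma exists_lfun (U V : vectType C) (f : U -> V) :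
  linear f -> exists h : 'Hom(U, V), h =1 f.
Proof.
move=> fL; pose fM := GRing.isLinear.Build _ _ _ _ f fL.
pose fl : {linear U -> V} := HB.pack f fM.
by exists (linfun fl) => u; rewrite lfunE.
Qed.

Lemma riesz (V : hspace C) (phi : 'Hom(V, C^o)) :
  exists v : V, forall u : V, phi u = '[u, v].
Proof.
have [->|phiN0] := eqVneq phi 0.
  by exists 0 => u; rewrite lfunE /= linear0r.
have [x phix] : exists x, phi x != 0.
  have: ~~ (fullv <= lker phi)%VS.
    apply: contra phiN0 => /subvP h; apply/eqP/lfunP => u.
    by rewrite lfunE /=; apply/eqP; rewrite -memv_ker h ?memvf.
  by case/subvPn => x _; rewrite memv_ker; exists x.
have [X KX [Y [xE _ YK]]] := orthogonal_split (hs_form V) (vbasis (lker phi)) x.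
have {}KX : phi X = 0.
  by apply/eqP; rewrite -memv_ker -(span_basis (vbasisP (lker phi))).
have phiY : phi Y != 0 by move: phix; rewrite xE linearD /= KX add0r.
have YN0 : Y != 0 by apply: contraNneq phiY => ->; rewrite linear0.
have YYN0 : '[Y, Y] != 0 by rewrite dnorm_eq0.
have KY (w : V) : phi w = 0 -> '[w, Y] = 0.
  move=> w0; have wK : w \in <<vbasis (lker phi)>>%VS.
    by rewrite (span_basis (vbasisP _)) memv_ker w0.
  apply: (span_orthogonal (S1 := vbasis (lker phi)) (S2 := [:: Y])) => //.
    by rewrite orthogonal_sym.
  by rewrite memv_span ?mem_head.
exists ((phi Y / '[Y, Y])^* *: Y) => u.
rewrite linearZr_LR /= conjCK.
have /KY : phi (u - (phi u / phi Y : C) *: Y) = 0.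
  by rewrite linearB linearZ /= -[X in _ - X]/(phi u / phi Y * phi Y) divfK ?subrr.
rewrite linearBl linearZl_LR /= => /eqP; rewrite subr_eq0 => /eqP ->.
by rewrite mulrC -mulrA [_ * (_ / _)]mulrCA mulfV // mulr1 divfK.
Qed.

Section Adjoint.

Variables (A B : hspace C) (T : 'Hom(A, B)).

(* The adjoint identity on bases, which makes it a decidable property. *)
Definition is_adjb (S : 'Hom(B, A)) : bool :=
  [forall i : 'I_(\dim {: A}), forall j : 'I_(\dim {: B}),
    '[T (vbasis {: A})`_i, (vbasis {: B})`_j]
      == '[(vbasis {: A})`_i, S (vbasis {: B})`_j]].

Lemma is_adjbP (S : 'Hom(B, A)) :
  reflect (forall a b, '[T a, b] = '[a, S b]) (is_adjb S).
Proof.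
apply: (iffP forallP) => [h a b|h i]; last by apply/forallP => j; rewrite h.
rewrite (coord_vbasis (memvf a)) (coord_vbasis (memvf b)).
rewrite [T _]linear_sum [S _]linear_sum !linear_sumlz; apply: eq_bigr => i _.
rewrite !linear_sumr; apply: eq_bigr => j _.
rewrite /= [T _]linearZ [S _]linearZ /= !linearZl_LR !linearZr_LR /=.
by move/forallP: (h i) => /(_ j)/eqP->.
Qed.

Lemma adj_exists : exists S : 'Hom(B, A), is_adjb S.
Proof.
pose f := vbasis {: B}.
have /fin_all_exists[r rP] (j : 'I_(\dim {: B})) :
    exists v : A, forall u : A, '[T u, f`_j] = '[u, v].
  have phiL : linear (fun u : A => '[T u, f`_j] : C^o).
    by move=> c u v; rewrite linearP linearDl linearZl_LR.
  have [phi phiE] := exists_lfun phiL.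
  by have [v vP] := riesz phi; exists v => u; rewrite -vP phiE.
have SL : linear (fun b : B => \sum_j (coord f j b *: r j : A)).
  move=> c u v; rewrite scaler_sumr -big_split; apply: eq_bigr => j _ /=.
  by rewrite linearP scalerDl scalerA.
have [S SE] := exists_lfun SL; exists S.
apply/is_adjbP => a b; rewrite SE linear_sumr.
rewrite [in LHS](coord_vbasis (memvf b)) linear_sumr; apply: eq_bigr => j _.
by rewrite !linearZr_LR /= rP.
Qed.

Definition adj : 'Hom(B, A) := xchoose adj_exists.

Lemma adjP a b : '[T a, b] = '[a, adj b].
Proof. exact: (is_adjbP _ (xchooseP adj_exists)). Qed.

End Adjoint.

Definition ltrace (V : vectType C) (T : 'End(V)) : C :=
  \tr (passmx.mxof (vbasis {: V}) (vbasis {: V}) T).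

(* Normalized Hilbert-Schmidt product (1 / dim A) tr (T2^* T1). *)
Definition hs_dot (A B : hspace C) (T1 T2 : 'Hom(A, B)) : C :=
  (hdim A)^-1 * ltrace (adj T2 \o T1)%VF.

Definition orthonormal_basis (E : vectType C) (form : E -> E -> C)
    (H : {vspace E}) (I : finType) (b : I -> E) : Prop :=
  basis_of H (codom b) /\ forall i j, form (b i) (b j) = (i == j)%:R.

Definition orthogonal_projection (V : hspace C) (P : 'End(V))
    (U : {vspace V}) : Prop :=
  forall v, P v \in U /\ {in U, forall u, '[v - P v, u] = 0}.

End Operators.

Section Representations.

Variables (C : numClosedFieldType) (G : finGroupType).

(* Unitary representations of a subgroup D of G; the values of the action
   outside D carry no meaning. *)
Record urep (D : {group G}) (V : hspace C) := URep {
  act :> G -> 'End(V);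
  act1 : act 1%g = \1%VF;
  actM : {in D &, forall x y, act (x * y)%g = (act x \o act y)%VF};
  act_unitary : {in D, forall x u v, '[act x u, act x v] = '[u, v]}
}.

Section Hom.

Variables (D : {group G}) (A B : hspace C) (alpha : urep D A) (beta : urep D B).

Definition commdef (g : G) (T : 'Hom(A, B)) : 'Hom(A, B) :=
  (beta g \o T)%VF - (T \o alpha g)%VF.

Fact commdef_linear g : linear (commdef g).
Proof.
move=> c S T; rewrite /commdef comp_lfunDr comp_lfunDl -comp_lfunZr -comp_lfunZl.
by rewrite scalerBr opprD addrACA.
Qed.
HB.instance Definition _ g :=
  GRing.isLinear.Build _ _ _ _ (commdef g) (commdef_linear g).

(* Hom_D(A, B) *)
Definition homrep : {vspace 'Hom(A, B)} :=
  (\bigcap_(g in D) lker (linfun (commdef g)))%VS.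

Lemma homrepP T :
  reflect {in D, forall g, (beta g \o T)%VF = (T \o alpha g)%VF} (T \in homrep).
Proof.
apply: (iffP subv_bigcapP) => h g Dg.
  by apply/eqP; move: (h g Dg); rewrite -memvE memv_ker lfunE /= subr_eq0.
by rewrite -memvE memv_ker lfunE /= subr_eq0 h.
Qed.

End Hom.

Lemma homrep1 D V (rho : urep D V) : \1%VF \in homrep rho rho.
Proof. by apply/homrepP => g _; rewrite comp_lfun1l comp_lfun1r. Qed.

Lemma homrep_comp D A1 A2 A3 (r1 : urep D A1) (r2 : urep D A2) (r3 : urep D A3)
    S T :
  S \in homrep r2 r3 -> T \in homrep r1 r2 -> (S \o T)%VF \in homrep r1 r3.
Proof.
move=> /homrepP hS /homrepP hT; apply/homrepP => g Dg.
by rewrite comp_lfunA hS // -comp_lfunA hT // comp_lfunA.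
Qed.

Section Irreducible.

Variables (D : {group G}) (V : hspace C) (rho : urep D V).

Definition invariant (U : {vspace V}) : Prop :=
  {in D, forall g, (rho g @: U <= U)%VS}.

Definition irreducible_on (U : {vspace V}) : Prop :=
  [/\ U <> 0%VS, invariant U
    & forall U' : {vspace V}, (U' <= U)%VS -> invariant U' ->
        U' = 0%VS \/ U' = U].

Definition irreducible : Prop := irreducible_on fullv.

(* The representation beta is equivalent to the restriction of rho to U. *)
Definition equivalent_to_sub (W : hspace C) (beta : urep D W)
    (U : {vspace V}) : Prop :=
  exists T : 'Hom(W, V), [/\ T \in homrep beta rho, lker T = 0%VS & limg T = U].

End Irreducible.

Definition equivalent D A B (alpha : urep D A) (beta : urep D B) : Prop :=
  equivalent_to_sub beta alpha fullv.

Definition contained D A B (alpha : urep D A) (beta : urep D B) : Prop :=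
  exists2 U, invariant beta U & equivalent_to_sub beta alpha U.

(* m is the number of constituents equivalent to alpha in a decomposition of
   beta into irreducible subrepresentations. *)
Definition multiplicity D A B (alpha : urep D A) (beta : urep D B)
    (m : nat) : Prop :=
  exists (n : nat) (U : 'I_n -> {vspace B}) (S : {set 'I_n}),
    [/\ (\sum_i U i)%VS = fullv /\ directv (\sum_i U i),
        forall i, irreducible_on beta (U i),
        forall i, i \in S <-> equivalent_to_sub beta alpha (U i)
      & #|S| = m].

Section Restriction.

Variables (K : {group G}) (W : hspace C) (sigma : urep [set: G]%G W).

Fact res_actM :
  {in K &, forall x y, sigma (x * y)%g = (sigma x \o sigma y)%VF}.
Proof. by move=> x y _ _; apply: actM; rewrite inE. Qed.

Fact res_unitary : {in K, forall x u v, '[sigma x u, sigma x v] = '[u, v]}.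
Proof. by move=> x _; apply: act_unitary; rewrite inE. Qed.

Definition res_rep : urep K W := URep (act1 sigma) res_actM res_unitary.

End Restriction.

Section Induction.

Variables (K : {group G}) (V : hspace C) (theta : urep K V).

Definition inddef (g k : G) (f : {ffun G -> V}) : V :=
  f (g * k)%g - theta k^-1%g (f g).

Fact inddef_linear g k : linear (inddef g k).
Proof.
move=> c f1 f2; rewrite /inddef !ffunE [theta _ _]linearP /=.
by rewrite scalerBr opprD addrACA.
Qed.
HB.instance Definition _ g k :=
  GRing.isLinear.Build _ _ _ _ (inddef g k) (inddef_linear g k).

Definition ind_vs : {vspace {ffun G -> V}} :=
  (\bigcap_g \bigcap_(k in K) lker (linfun (inddef g k)))%VS.

Lemma ind_vsP (f : {ffun G -> V}) :
  reflect (forall g, {in K, forall k, f (g * k)%g = theta k^-1%g (f g)})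
          (f \in ind_vs).
Proof.
apply: (iffP subv_bigcapP) => h g.
  move=> k Kk; apply/eqP; move/(_ g isT)/subv_bigcapP: h => /(_ k Kk).
  by rewrite -memvE memv_ker lfunE /= subr_eq0.
move=> _; apply/subv_bigcapP => k Kk.
by rewrite -memvE memv_ker lfunE /= subr_eq0 h.
Qed.

Definition ind_form (f1 f2 : subvs_of ind_vs) : C :=
  (#|K|%:R)^-1 * \sum_g '[vsval f1 g, vsval f2 g].

Fact ind_form_bilinear :
  bilinear_for *%R (Num.conj \; *%R) ind_form.
Proof.
split=> [v c u1 u2|u c v1 v2] /=; rewrite /ind_form mulrCA -mulrDr.
  rewrite [X in _ * (X + _)]mulr_sumr -big_split; congr (_ * _).
  apply: eq_bigr => g _ /=.
  by rewrite !ffunE linearDl linearZl_LR.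
rewrite [X in _ * (X + _)]mulr_sumr -big_split; congr (_ * _).
apply: eq_bigr => g _ /=.
by rewrite !ffunE linearDr linearZr_LR.
Qed.
HB.instance Definition _ :=
  bilinear_isBilinear.Build _ _ _ _ _ _ ind_form ind_form_bilinear.

Fact ind_form_herm f1 f2 :
  ind_form f1 f2 = (-1) ^+ false * Num.conj (ind_form f2 f1).
Proof.
rewrite mul1r /ind_form rmorphM fmorphV rmorph_nat rmorph_sum; congr (_ * _).
by apply: eq_bigr => g _; rewrite hermC mul1r.
Qed.
HB.instance Definition _ :=
  isHermitianSesquilinear.Build _ _ _ _ ind_form ind_form_herm.

Fact ind_form_gt0 f : f != 0 -> 0 < ind_form f f.
Proof.
move=> fN0; rewrite mulr_gt0 ?invr_gt0 ?ltr0n ?cardG_gt0 //.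
have [g fg] : exists g, vsval f g != 0.
  apply/existsP; apply: contraNT fN0; rewrite negb_exists => /forallP f0.
  apply/eqP/val_inj/ffunP => g /=; rewrite !ffunE.
  by apply/eqP; rewrite -[_ == _]negbK f0.
rewrite (bigD1 g) //= ltr_pwDl ?dnorm_gt0 // sumr_ge0 //.
Qed.
HB.instance Definition _ := isDotProduct.Build _ _ ind_form ind_form_gt0.

Definition ind_space : hspace C := @HSpace C (subvs_of ind_vs) ind_form.

Definition translate (g0 : G) (f : {ffun G -> V}) : {ffun G -> V} :=
  [ffun g => f (g0^-1 * g)%g].

Fact translate_linear g0 : linear (translate g0).
Proof. by move=> c f1 f2; apply/ffunP => g; rewrite !ffunE. Qed.
HB.instance Definition _ g0 :=
  GRing.isLinear.Build _ _ _ _ (translate g0) (translate_linear g0).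

Lemma translate_ind g0 f : f \in ind_vs -> translate g0 f \in ind_vs.
Proof.
by move=> /ind_vsP h; apply/ind_vsP => g k Kk; rewrite !ffunE mulgA h.
Qed.

Definition ind_act (g0 : G) : 'End(ind_space) :=
  linfun (vsproj ind_vs \o translate g0 \o vsval).

Lemma ind_actE g0 (f : ind_space) g :
  vsval (ind_act g0 f) g = vsval f (g0^-1 * g)%g.
Proof. by rewrite lfunE /= vsprojK ?translate_ind ?subvsP // ffunE. Qed.

Fact ind_act1 : ind_act 1%g = \1%VF.
Proof.
apply/lfunP => f; apply/val_inj/ffunP => g /=.
by rewrite ind_actE lfunE /= invg1 mul1g.
Qed.

Fact ind_actM : {in [set: G]%G &, forall x y,
  ind_act (x * y)%g = (ind_act x \o ind_act y)%VF}.
Proof.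
move=> x y _ _; apply/lfunP => f; apply/val_inj/ffunP => g /=.
by rewrite comp_lfunE !ind_actE invMg mulgA.
Qed.

Fact ind_unitary : {in [set: G]%G, forall x (u v : ind_space),
  '[ind_act x u, ind_act x v] = '[u, v]}.
Proof.
move=> x _ u v; rewrite /= /ind_form; congr (_ * _).
rewrite [RHS](reindex_inj (mulgI x^-1%g)); apply: eq_bigr => g _ /=.
by rewrite !ind_actE.
Qed.

Definition ind_rep : urep [set: G]%G ind_space :=
  URep ind_act1 ind_actM ind_unitary.

Section Diamond.

Variables (W : hspace C) (sigma : urep [set: G]%G W).

Definition diamond_fun (L : 'Hom(V, W)) (f : ind_space) : W :=
  (sqrtC (#|G|%:R * #|K|%:R))^-1 *: \sum_g sigma g (L (vsval f g)).

Fact diamond_linear L : linear (diamond_fun L).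
Proof.
move=> c f1 f2; rewrite /diamond_fun scalerA [c * _]mulrC -scalerA -scalerDr.
rewrite [X in _ *: (X + _)]scaler_sumr -big_split; congr (_ *: _).
by apply: eq_bigr => g _ /=; rewrite !ffunE !linearP.
Qed.
HB.instance Definition _ L :=
  GRing.isLinear.Build _ _ _ _ (diamond_fun L) (diamond_linear L).

(* L^\diamond *)
Definition diamond (L : 'Hom(V, W)) : 'Hom(ind_space, W) :=
  linfun (diamond_fun L).

Variables (m : nat) (L : 'I_m -> 'Hom(V, W)).

(* U_(i,j), T_i and the matrix FT(sigma), for a family L in Hom_K(V, W). *)
Definition Uop (i j : 'I_m) : 'End(ind_space) :=
  (hdim W / hdim V) *: (adj (diamond (L i)) \o diamond (L j))%VF.

Definition Top (i : 'I_m) : 'Hom(W, ind_space) :=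
  sqrtC (hdim W / hdim V) *: adj (diamond (L i)).

Definition fourier (T : 'End(ind_space)) : 'M[C]_m :=
  \matrix_(i, j)
    (hdim V * (#|[set: G] : K|%g)%:R / hdim W * hs_dot T (Uop i j)).

End Diamond.

End Induction.

End Representations.

Section Algebras.

Variables (C : numClosedFieldType) (X : vectType C).

(* In this section A stands for a unital algebra of operators on X, under
   composition; maps are only constrained on A. *)
Variable A : {vspace 'End(X)}.

Record alg_rep (M : vectType C) := AlgRep {
  alg_act :> 'End(X) -> 'End(M);
  alg_actP : forall a, {in A &, forall S T,
    alg_act (a *: S + T) = a *: alg_act S + alg_act T};
  alg_act1 : alg_act \1%VF = \1%VF;
  alg_actM : {in A &, forall S T,
    alg_act (S \o T)%VF = (alg_act S \o alg_act T)%VF}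
}.

Definition alg_irreducible (M : vectType C) (pi : alg_rep M) : Prop :=
  \dim {: M} <> 0%N /\
  forall U : {vspace M}, {in A, forall T, (pi T @: U <= U)%VS} ->
    U = 0%VS \/ U = fullv.

Definition is_character (M : vectType C) (pi : alg_rep M)
    (chi : 'End(X) -> C) : Prop :=
  {in A, forall T, chi T = ltrace (pi T)}.

Definition irreducible_character (chi : 'End(X) -> C) : Prop :=
  exists (M : vectType C) (pi : alg_rep M),
    alg_irreducible pi /\ is_character pi chi.

(* Isomorphism of A with the direct sum of the matrix algebras M_(m s),
   whose elements are families of matrices with pointwise operations. *)
Definition matrix_alg_isomorphism (J : finType) (m : J -> nat)
    (Phi : 'End(X) -> forall s, 'M[C]_(m s)) : Prop :=
  [/\ forall a, {in A &, forall S T, forall s,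
        Phi (a *: S + T) s = a *: Phi S s + Phi T s},
      forall s, Phi \1%VF s = 1%:M,
      {in A &, forall S T, forall s,
        Phi (S \o T)%VF s = Phi S s *m Phi T s},
      {in A &, forall S T, (forall s, Phi S s = Phi T s) -> S = T}
    & forall F : (forall s, 'M[C]_(m s)),
        exists2 T, T \in A & forall s, Phi T s = F s].

End Algebras.

(* The commutant of rho acts on Hom_D(W, X) by composition on the left. *)
Section LeftComposition.

Variables (C : numClosedFieldType) (G : finGroupType) (D : {group G}).
Variables (W X : hspace C) (sigma : urep D W) (rho : urep D X).

Definition lcomp_fun (T : 'End(X)) (S : subvs_of (homrep sigma rho)) :
  subvs_of (homrep sigma rho) :=
  vsproj (homrep sigma rho) (T \o vsval S)%VF.

Fact lcomp_linear T : linear (lcomp_fun T).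
Proof.
move=> c S1 S2; rewrite /lcomp_fun -linearP; congr vsproj.
by rewrite linearP comp_lfunDr -comp_lfunZr.
Qed.
HB.instance Definition _ T :=
  GRing.isLinear.Build _ _ _ _ (lcomp_fun T) (lcomp_linear T).

Definition lcomp_act (T : 'End(X)) : 'End(subvs_of (homrep sigma rho)) :=
  linfun (lcomp_fun T).

Lemma lcomp_actE T S : T \in homrep rho rho ->
  vsval (lcomp_act T S) = (T \o vsval S)%VF.
Proof. by move=> hT; rewrite lfunE /= vsprojK ?(homrep_comp hT) ?subvsP. Qed.

Fact lcomp_actP a : {in homrep rho rho &, forall S T,
  lcomp_act (a *: S + T) = a *: lcomp_act S + lcomp_act T}.
Proof.
move=> S T hS hT; apply/lfunP => Z; apply/subvs_inj.
rewrite lcomp_actE ?memvD ?memvZ // add_lfunE scale_lfunE linearP /=.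
by rewrite !lcomp_actE // comp_lfunDl -comp_lfunZl.
Qed.

Fact lcomp_act1 : lcomp_act \1%VF = \1%VF.
Proof.
apply/lfunP => Z; apply/subvs_inj.
by rewrite lcomp_actE ?homrep1 // comp_lfun1l id_lfunE.
Qed.

Fact lcomp_actM : {in homrep rho rho &, forall S T,
  lcomp_act (S \o T)%VF = (lcomp_act S \o lcomp_act T)%VF}.
Proof.
move=> S T hS hT; apply/lfunP => Z; apply/subvs_inj.
by rewrite comp_lfunE !lcomp_actE ?(homrep_comp hS) // comp_lfunA.
Qed.

Definition lcomp_rep :
    alg_rep (homrep rho rho) (subvs_of (homrep sigma rho)) :=
  AlgRep lcomp_actP lcomp_act1 lcomp_actM.

End LeftComposition.

(* Main.v *)
(* A family of isometric intertwiners T_(s,i) from pairwise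
   inequivalent irreducibles W_s into a representation H, with orthogonal
   images and \sum T_(s,i) T_(s,i)^* = 1, makes the operators
   T_(s,i) T_(s,j)^* matrix units of the commutant of H: by Schur's lemma
   T_(s,i)^* X T_(t,j) is zero for s <> t and a scalar c_(i,j)(X) for s = t,
   and X |-> c(X) is the Fourier transform.  Everything except the existence
   of such a family then follows formally.
   For H = Ind V one takes multiples of the adjoints of the L_(s,i)^\diamond;
   averaging over G and Schur's lemma give
   L1^\diamond (L2^\diamond)^* = (dim V / dim W) <L1, L2>.  They are complete
   because the complement of the sum of their images would otherwise contain
   an irreducible subrepresentation; by Frobenius reciprocity the adjoint of
   its inclusion is L^\diamond for some L, hence a combination of the
   L_(s,i)^\diamond, all of which vanish there. *)
From HB Require Import structures.
Require Import Defs.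
From mathcomp Require Import all_boot all_order all_fingroup all_algebra.
From mathcomp Require Import sesquilinear spectral boolp reals complex.

Set Implicit Arguments.
Unset Strict Implicit.
Unset Printing Implicit Defensive.

Import GRing.Theory Num.Theory Num.Def.
Local Open Scope ring_scope.

(** * Adjoints, traces and eigenvectors of linear maps *)

Section Forms.

Variable C : numClosedFieldType.

Lemma form_inj (V : hspace C) (u v : V) : (forall w, '[w, u] = '[w, v]) -> u = v.
Proof.
move=> h; apply/eqP; rewrite -subr_eq0 -(dnorm_eq0 (hs_form V)).
by rewrite linearBr /= h subrr.
Qed.

Lemma form_conj (V : hspace C) (u v : V) : '[u, v] = '[v, u]^*.
Proof. by rewrite hermC mul1r. Qed.

Lemma adj_unique (A B : hspace C) (T : 'Hom(A, B)) (S : 'Hom(B, A)) :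
  (forall a b, '[T a, b] = '[a, S b]) -> adj T = S.
Proof. by move=> h; apply/lfunP => b; apply: form_inj => a; rewrite -adjP h. Qed.

Lemma adjPr (A B : hspace C) (T : 'Hom(A, B)) a b : '[adj T b, a] = '[b, T a].
Proof. by rewrite form_conj -adjP -form_conj. Qed.

Lemma adjK (A B : hspace C) (T : 'Hom(A, B)) : adj (adj T) = T.
Proof. by apply: adj_unique => a b; rewrite adjPr. Qed.

Lemma adj_comp (A1 A2 A3 : hspace C) (T : 'Hom(A2, A3)) (S : 'Hom(A1, A2)) :
  adj (T \o S)%VF = (adj S \o adj T)%VF.
Proof. by apply: adj_unique => a b; rewrite !comp_lfunE !adjP. Qed.

Lemma adj_lfunZ (A B : hspace C) c (T : 'Hom(A, B)) : adj (c *: T) = c^* *: adj T.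
Proof.
apply: adj_unique => a b.
by rewrite !scale_lfunE linearZl_LR linearZr_LR /= conjCK adjP.
Qed.

Lemma comp_lfun_suml (A1 A2 A3 : vectType C) (I : finType)
    (F : I -> 'Hom(A2, A3)) (S : 'Hom(A1, A2)) :
  ((\sum_i F i) \o S)%VF = \sum_i (F i \o S)%VF.
Proof.
apply/lfunP => u; rewrite comp_lfunE !sum_lfunE.
by apply: eq_bigr => i _; rewrite comp_lfunE.
Qed.

Lemma comp_lfun_sumr (A1 A2 A3 : vectType C) (I : finType)
    (F : I -> 'Hom(A1, A2)) (S : 'Hom(A2, A3)) :
  (S \o (\sum_i F i))%VF = \sum_i (S \o F i)%VF.
Proof.
apply/lfunP => u; rewrite comp_lfunE !sum_lfunE linear_sum.
by apply: eq_bigr => i _; rewrite comp_lfunE.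
Qed.

Lemma lker_eq0P (A B : vectType C) (T : 'Hom(A, B)) :
  (forall x, T x = 0 -> x = 0) -> lker T = 0%VS.
Proof.
move=> h; apply/eqP; rewrite -subv0; apply/subvP => x.
by rewrite memv_ker memv0 => /eqP/h/eqP.
Qed.

Import passmx.

Lemma ltraceC (A B : vectType C) (S : 'Hom(A, B)) (T : 'Hom(B, A)) :
  ltrace (T \o S)%VF = ltrace (S \o T)%VF.
Proof.
rewrite /ltrace (mxof_comp _ _ (vbasisP {: B})).
by rewrite (mxof_comp _ _ (vbasisP {: A})) mxtrace_mulC.
Qed.

Lemma ltraceD (V : vectType C) (S T : 'End(V)) :
  ltrace (S + T) = ltrace S + ltrace T.
Proof. by rewrite /ltrace !raddfD. Qed.

Lemma ltraceZ (V : vectType C) c (T : 'End(V)) : ltrace (c *: T) = c * ltrace T.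
Proof. by rewrite /ltrace linearZ linearZ. Qed.

Lemma ltrace0 (V : vectType C) : ltrace (0 : 'End(V)) = 0.
Proof. by rewrite /ltrace !linear0. Qed.

Lemma ltrace1 (V : vectType C) : ltrace (\1%VF : 'End(V)) = (\dim {: V})%:R.
Proof.
by rewrite /ltrace mxof1 ?(basis_free (vbasisP _)) // mxtrace1.
Qed.

(** [ltrace] is defined through [vbasis]; cyclicity of the matrix trace makes it independent of the
    basis, so characters can be computed in an adapted one. *)
Lemma ltrace_basis (V : vectType C) (T : 'End(V)) n (e : n.-tuple V) :
  basis_of fullv e -> ltrace T = \sum_i coord e i (T e`_i).
Proof.
move=> eP; have nE : \dim {: V} = n := size_basis eP.
case: _ / nE e eP => e eP.
pose b := vbasis {: V}; have bP : basis_of fullv b := vbasisP _.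
(* The two inserted identities become the change-of-basis matrices between [b] and [e]; cycling one
   of them round turns the matrix of [T] in [b] into its matrix in [e]. *)
rewrite /ltrace -[T in LHS]comp_lfun1r -[(_ \o _)%VF]comp_lfun1l.
rewrite (mxof_comp _ _ eP) mxtrace_mulC (mxof_comp _ _ bP) mulmxA.
rewrite -!mxof_comp // !comp_lfun1l comp_lfun1r.
by apply: eq_bigr => i _; rewrite /mxof /lin1_mx mxE /= vecof_delta -coord_rVof.
Qed.

Lemma exists_eigenvector (V : vectType C) (T : 'End(V)) :
  \dim {: V} != 0%N -> exists (a : C) (v : V), v != 0 /\ T v = a *: v.
Proof.
rewrite -lt0n => V0.
pose b := vbasis {: V}; have bP : basis_of fullv b := vbasisP _.
have [a /eigenvalueP[u uE u0]] := eigenvalue_closed (mxof b b T) V0.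
exists a, (vecof b u); split; first by rewrite vecof_eq0.
by rewrite (hom_vecof _ bP) uE linearZ.
Qed.

End Forms.

(** * Schur's lemma for unitary representations *)

Section Schur.

Variables (C : numClosedFieldType) (G : finGroupType) (D : {group G}).

Lemma act_invK (A : hspace C) (alpha : urep D A) g :
  g \in D -> cancel (alpha g) (alpha g^-1%g).
Proof.
move=> Dg a; have /lfunP/(_ a) := Defs.actM alpha (groupVr Dg) Dg.
by rewrite mulVg Defs.act1 id_lfunE comp_lfunE.
Qed.

Lemma act_adj (A : hspace C) (alpha : urep D A) g :
  g \in D -> adj (alpha g) = alpha g^-1%g.
Proof.
move=> Dg; apply: adj_unique => a b.
by rewrite -(act_unitary alpha (groupVr Dg) (alpha g a) b) act_invK.
Qed.

(** By unitarity the adjoint of the action of g is the action of its inverse, so one takes adjoints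
    in the intertwining relation at the inverse of g. *)
Lemma adj_homrep (A B : hspace C) (alpha : urep D A) (beta : urep D B) T :
  T \in homrep alpha beta -> adj T \in homrep beta alpha.
Proof.
move=> /homrepP hT; apply/homrepP => g Dg.
have /(congr1 (@adj _ _ _)) := hT g^-1%g (groupVr Dg).
by rewrite !adj_comp !act_adj ?groupV // invgK.
Qed.

Lemma lker_invariant (A B : hspace C) (alpha : urep D A) (beta : urep D B) T :
  T \in homrep alpha beta -> Defs.invariant alpha (lker T).
Proof.
move=> /homrepP hT g Dg; apply/subvP => _ /memv_imgP[x + ->].
rewrite !memv_ker -!comp_lfunE -hT // comp_lfunE => /eqP ->.
by rewrite linear0.
Qed.

Lemma limg_invariant (A B : hspace C) (alpha : urep D A) (beta : urep D B) T :
  T \in homrep alpha beta -> Defs.invariant beta (limg T).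
Proof.
move=> /homrepP hT g Dg; apply/subvP => _ /memv_imgP[_ /memv_imgP[x _ ->] ->].
by rewrite -comp_lfunE hT // comp_lfunE memv_img ?memvf.
Qed.

Lemma irreducible_hom (A B : hspace C) (alpha : urep D A) (beta : urep D B) T :
  irreducible alpha -> irreducible beta -> T \in homrep alpha beta -> T != 0 ->
  lker T = 0%VS /\ limg T = fullv.
Proof.
move=> [_ _ irrA] [_ _ irrB] hT T0; split.
  have [//|kf] := irrA _ (subvf _) (lker_invariant hT).
  case/eqP: T0; apply/lfunP => x; rewrite zero_lfunE; apply/eqP.
  by rewrite -memv_ker kf memvf.
have [i0|//] := irrB _ (subvf _) (limg_invariant hT).
case/eqP: T0; apply/lfunP => x; rewrite zero_lfunE; apply/eqP.
by rewrite -memv0 -i0 memv_img ?memvf.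
Qed.

Lemma irreducible_dim (A : hspace C) (alpha : urep D A) :
  irreducible alpha -> hdim A != 0.
Proof.
by case=> A0 _ _; rewrite /hdim pnatr_eq0 dimv_eq0; apply/eqP.
Qed.

Lemma inequivalent_hom0 (A B : hspace C) (alpha : urep D A) (beta : urep D B) T :
  irreducible alpha -> irreducible beta -> ~ equivalent alpha beta ->
  T \in homrep alpha beta -> T = 0.
Proof.
move=> irrA irrB neq hT; apply/eqP/negPn/negP => T0; apply: neq.
by have [? ?] := irreducible_hom irrA irrB hT T0; exists T.
Qed.

(** If a is an eigenvalue of [T], then [T - a] is an intertwiner with nonzero kernel, hence zero.
    Expressing a as a normalized trace gives a formula for it in terms of [T]. *)
Lemma schur_scalar (A : hspace C) (alpha : urep D A) T :
  irreducible alpha -> T \in homrep alpha alpha ->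
  T = ((hdim A)^-1 * ltrace T) *: \1%VF.
Proof.
move=> irrA hT; have d0 := irreducible_dim irrA.
have d0' : \dim {: A} != 0%N by move: d0; rewrite /hdim pnatr_eq0.
have [a [v [v0 Tv]]] := exists_eigenvector T d0'.
have -> : T = a *: \1%VF.
  have hS : T - a *: \1%VF \in homrep alpha alpha.
    by rewrite memvB ?memvZ ?homrep1.
  apply/eqP; rewrite -subr_eq0; apply/negPn/negP => S0.
  have [k0 _] := irreducible_hom irrA irrA hS S0.
  case/negP: v0; rewrite -memv0 -k0 memv_ker.
  by rewrite add_lfunE opp_lfunE scale_lfunE id_lfunE Tv subrr.
by rewrite ltraceZ ltrace1 mulrCA mulVf ?mulr1.
Qed.

End Schur.

(** Pairing a vanishing combination with [b i] isolates its i-th coefficient, which gives freeness;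
    spanning is the last hypothesis. [F] is a plain function so that [hs_dot] fits. *)
Lemma codom_basis (C : numClosedFieldType) (E : vectType C) (F : E -> E -> C)
    (H : {vspace E}) (I : finType) (b : I -> E) :
  (forall e, linear_for *%R (F ^~ e)) -> (forall i, b i \in H) ->
  (forall i j, F (b i) (b j) = (i == j)%:R) ->
  {in H, forall x, exists k : I -> C, x = \sum_i k i *: b i} ->
  basis_of H (codom b).
Proof.
move=> Flin bH Fb Hb; have F0 e : F 0 e = 0.
  by have := Flin e (-1) 0 0; rewrite scaler0 addr0 mulN1r addNr.
have Fsum e (k : I -> C) : F (\sum_i k i *: b i) e = \sum_i k i * F (b i) e.
  apply: (big_ind2 (fun x y => F x e = y)) => // [x1 x2 y1 y2 <- <-|i _].
    by rewrite -[x1]scale1r Flin mul1r scale1r.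
  by rewrite -[_ *: _]addr0 Flin F0 addr0.
rewrite /basis_of eqEsubv -andbA; apply/and3P; split.
- by apply/span_subvP => _ /codomP[i ->].
- apply/subvP => x /Hb[k ->]; apply: memv_suml => i _.
  by rewrite memvZ // memv_span // codom_f.
- have -> : codom b = [tuple of codom b] by [].
  apply/freeP => k k0 i.
  (* Freeness of a tuple is stated with ordinal indices; the enumeration of [I] carries the relation
     back to a sum over [I]. *)
  have sE : \sum_j k (enum_rank j) *: b j = 0.
    rewrite -[RHS]k0 (reindex (@enum_val I predT)) /=; last first.
      by apply: onW_bij; apply: enum_val_bij.
    apply: eq_bigr => j _; rewrite enum_valK; congr (_ *: _).
    by rewrite /codom /image_mem (nth_map (enum_val j)) -?enum_val_nth // -cardE.
  have := Fsum (b (enum_val i)) (fun j => k (enum_rank j)).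
  rewrite sE F0 (bigD1 (enum_val i)) //= Fb eqxx mulr1 enum_valK big1 ?addr0.
    by move=> <-.
  by move=> j /negPf ji; rewrite Fb ji mulr0.
Qed.

(** * Linearity of algebra representations over finite sums *)

Section AlgebraRepresentation.

Variables (C : numClosedFieldType) (X : vectType C) (A : {vspace 'End(X)}).
Variables (M : vectType C) (pi : alg_rep A M).

Lemma alg_act0 : pi 0 = 0.
Proof.
have := alg_actP pi (-1) (mem0v A) (mem0v A).
by rewrite scaler0 addr0 scaleN1r addNr.
Qed.

Lemma alg_act_sum (I : finType) (k : I -> C) (F : I -> 'End(X)) :
  (forall i, F i \in A) -> pi (\sum_i k i *: F i) = \sum_i k i *: pi (F i).
Proof.
(* Since [pi] is constrained only on [A], membership of the partial sums has to be carried through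
   the induction. *)
move=> hF; suff [] : \sum_i k i *: F i \in A /\
    pi (\sum_i k i *: F i) = \sum_i k i *: pi (F i) by [].
pose P S S' := S \in A /\ pi S = S'.
apply: (big_ind2 P) => [|S1 S1' S2 S2' [h1 <-] [h2 <-]|i _].
- by split; [exact: mem0v | exact: alg_act0].
- split; first exact: memvD.
  by rewrite -[S1]scale1r alg_actP // !scale1r.
by split; rewrite ?memvZ // -[_ *: _]addr0 alg_actP ?mem0v // alg_act0 addr0.
Qed.

End AlgebraRepresentation.

(** * The commutant of an orthogonally decomposed representation *)

Section Decomposition.

Variables (C : numClosedFieldType) (G : finGroupType) (D : {group G}).
Variables (H : hspace C) (rho : urep D H).
Variables (J : finType) (W : J -> hspace C) (sigma : forall s, urep D (W s)).
Variables (m : J -> nat) (T : forall s, 'I_(m s) -> 'Hom(W s, H)).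

Hypothesis sigma_irr : forall s, irreducible (sigma s).
Hypothesis sigma_inequiv :
  forall s t, s != t -> ~ equivalent (sigma s) (sigma t).
Hypothesis T_hom : forall s i, T i \in homrep (sigma s) rho.
Hypothesis T_orthonormal :
  forall s (i j : 'I_(m s)), (adj (T i) \o T j)%VF = (i == j)%:R *: \1%VF.
Hypothesis T_complete : \sum_s \sum_(i < m s) (T i \o adj (T i))%VF = \1%VF.

Local Notation A := (homrep rho rho).

Definition munit s (i j : 'I_(m s)) : 'End(H) := (T i \o adj (T j))%VF.

(** For [X] in the commutant this is the Schur scalar of the compressed operator; the trace form
    makes it a linear function of every endomorphism [X]. *)
Definition mcoef (X : 'End(H)) s (i j : 'I_(m s)) : C :=
  (hdim (W s))^-1 * ltrace (adj (T i) \o (X \o T j))%VF.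

Lemma munit_hom s (i j : 'I_(m s)) : munit i j \in A.
Proof. exact: homrep_comp (T_hom _) (adj_homrep (T_hom _)). Qed.

Lemma sandwich_hom X s (i : 'I_(m s)) t (j : 'I_(m t)) : X \in A ->
  (adj (T i) \o (X \o T j))%VF \in homrep (sigma t) (sigma s).
Proof.
move=> hX; apply: homrep_comp (adj_homrep (T_hom i)) _.
exact: homrep_comp hX (T_hom j).
Qed.

Lemma mcoefE X s (i j : 'I_(m s)) : X \in A ->
  (adj (T i) \o (X \o T j))%VF = mcoef X i j *: \1%VF.
Proof. by move=> hX; apply: schur_scalar (sandwich_hom _ _ hX). Qed.

Lemma sandwich_inequiv X s (i : 'I_(m s)) t (j : 'I_(m t)) :
  X \in A -> s != t -> (adj (T i) \o (X \o T j))%VF = 0.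
Proof.
move=> hX st; have ts : t != s by rewrite eq_sym.
exact: inequivalent_hom0 (sigma_inequiv ts) (sandwich_hom i j hX).
Qed.

Lemma T_orthogonal s (i : 'I_(m s)) t (j : 'I_(m t)) :
  s != t -> (adj (T i) \o T j)%VF = 0.
Proof.
by move=> st; rewrite -(sandwich_inequiv i j (homrep1 rho) st) comp_lfun1l.
Qed.

Lemma mcoef_unique X s (i j : 'I_(m s)) a :
  (adj (T i) \o (X \o T j))%VF = a *: \1%VF -> mcoef X i j = a.
Proof.
move=> h; rewrite /mcoef h ltraceZ ltrace1 mulrCA mulVf ?mulr1 //.
exact: irreducible_dim (sigma_irr s).
Qed.

Lemma T_expand (B : vectType C) (S : 'Hom(B, H)) :
  S = \sum_s \sum_(i < m s) (T i \o (adj (T i) \o S))%VF.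
Proof.
rewrite -[S in LHS]comp_lfun1l -T_complete comp_lfun_suml.
apply: eq_bigr => s _; rewrite comp_lfun_suml; apply: eq_bigr => i _.
by rewrite comp_lfunA.
Qed.

(** Insert the resolution of the identity to the left of [X]: the blocks with t different from s
    vanish by Schur, and those at s are scalars. Thus [X] acts on the [T i] as a matrix acts on
    basis vectors. *)
Lemma comp_T X s (j : 'I_(m s)) : X \in A ->
  (X \o T j)%VF = \sum_i mcoef X i j *: T i.
Proof.
move=> hX; rewrite [LHS]T_expand (bigD1 s) //= [X in _ + X]big1 ?addr0.
  by apply: eq_bigr => i _; rewrite mcoefE // -comp_lfunZr comp_lfun1r.
move=> t ts; apply: big1 => i _.
by rewrite sandwich_inequiv // comp_lfun0r.
Qed.

Lemma comp_munit X s (i j : 'I_(m s)) : X \in A ->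
  (X \o munit i j)%VF = \sum_k mcoef X k i *: munit k j.
Proof.
move=> hX; rewrite comp_lfunA comp_T // comp_lfun_suml.
by apply: eq_bigr => k _; rewrite -comp_lfunZl.
Qed.

Lemma munit_complete : \sum_s \sum_(i < m s) munit i i = \1%VF.
Proof. exact: T_complete. Qed.

(** Fourier inversion: multiply [X] on the right by the sum of the diagonal units and expand each
    product by [comp_munit]. *)
Lemma munit_inversion X : X \in A ->
  X = \sum_s \sum_(i < m s) \sum_(j < m s) mcoef X i j *: munit i j.
Proof.
move=> hX; rewrite -[LHS]comp_lfun1r -munit_complete comp_lfun_sumr.
apply: eq_bigr => s _; rewrite comp_lfun_sumr exchange_big /=.
by apply: eq_bigr => j _; rewrite comp_munit.
Qed.

Lemma munit_T s (i j k : 'I_(m s)) :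
  (munit i j \o T k)%VF = (j == k)%:R *: T i.
Proof. by rewrite -comp_lfunA T_orthonormal -comp_lfunZr comp_lfun1r. Qed.

Lemma munit_T0 s (i j : 'I_(m s)) t (k : 'I_(m t)) :
  s != t -> (munit i j \o T k)%VF = 0.
Proof. by move=> st; rewrite -comp_lfunA T_orthogonal // comp_lfun0r. Qed.

Lemma mcoef_munit s (i j k l : 'I_(m s)) :
  mcoef (munit i j) k l = ((k == i) && (j == l))%:R.
Proof.
apply: mcoef_unique; rewrite munit_T -comp_lfunZr T_orthonormal scalerA.
by rewrite -natrM mulnb andbC.
Qed.

Lemma mcoef_munit0 s (i j : 'I_(m s)) t (k l : 'I_(m t)) :
  s != t -> mcoef (munit i j) k l = 0.
Proof.
by move=> st; apply: mcoef_unique; rewrite munit_T0 // comp_lfun0r scale0r.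
Qed.

Lemma mcoefD X Y s (i j : 'I_(m s)) : mcoef (X + Y) i j = mcoef X i j + mcoef Y i j.
Proof. by rewrite /mcoef comp_lfunDl comp_lfunDr ltraceD mulrDr. Qed.

Lemma mcoefZ a X s (i j : 'I_(m s)) : mcoef (a *: X) i j = a * mcoef X i j.
Proof. by rewrite /mcoef -comp_lfunZl -comp_lfunZr ltraceZ mulrCA. Qed.

Lemma mcoef_sum (I : finType) (F : I -> 'End(H)) s (i j : 'I_(m s)) :
  mcoef (\sum_k F k) i j = \sum_k mcoef (F k) i j.
Proof.
apply: (big_morph (fun X => mcoef X i j)) => [X Y|]; first exact: mcoefD.
by rewrite -[0](scale0r (0 : 'End(H))) mcoefZ mul0r.
Qed.

Lemma mcoef1 s (i j : 'I_(m s)) : mcoef \1%VF i j = (i == j)%:R.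
Proof. by apply: mcoef_unique; rewrite comp_lfun1l T_orthonormal. Qed.

(** Expanding [Y] applied to [T j] in the [T k] turns composition into the matrix product. *)
Lemma mcoefM X Y s (i j : 'I_(m s)) : X \in A -> Y \in A ->
  mcoef (X \o Y)%VF i j = \sum_k mcoef X i k * mcoef Y k j.
Proof.
move=> hX hY; apply: mcoef_unique.
rewrite -comp_lfunA comp_T // comp_lfun_sumr comp_lfun_sumr scaler_suml.
apply: eq_bigr => k _; rewrite -!comp_lfunZr mcoefE // scalerA.
by rewrite mulrC.
Qed.

Definition mfourier (X : 'End(H)) s : 'M[C]_(m s) := \matrix_(i, j) mcoef X i j.

Lemma mfourier_iso : matrix_alg_isomorphism A mfourier.
Proof.
split.
- by move=> a X Y _ _ s; apply/matrixP => i j; rewrite !mxE mcoefD mcoefZ.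
- by move=> s; apply/matrixP => i j; rewrite !mxE mcoef1.
- move=> X Y hX hY s; apply/matrixP => i j; rewrite !mxE mcoefM //.
  by apply: eq_bigr => k _; rewrite !mxE.
- move=> X Y hX hY XY; rewrite (munit_inversion hX) (munit_inversion hY).
  apply: eq_bigr => s _; apply: eq_bigr => i _; apply: eq_bigr => j _.
  by have /matrixP/(_ i j) := XY s; rewrite !mxE => ->.
(* Surjectivity: the inversion formula dictates the preimage, and the coefficients of the units
   leave a single term of the triple sum. *)
move=> F; exists (\sum_s \sum_i \sum_j F s i j *: munit i j).
  apply: memv_suml => s _; apply: memv_suml => i _; apply: memv_suml => j _.
  by rewrite memvZ // munit_hom.
move=> s; apply/matrixP => i j; rewrite !mxE mcoef_sum.
rewrite (bigD1 s) //= [X in _ + X]big1 ?addr0; last first.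
  move=> t ts; rewrite mcoef_sum big1 // => k _; rewrite mcoef_sum big1 // => l _.
  by rewrite mcoefZ mcoef_munit0 ?mulr0.
rewrite mcoef_sum (bigD1 i) //= [X in _ + X]big1 ?addr0; last first.
  move=> k ki; rewrite mcoef_sum big1 // => l _.
  by rewrite mcoefZ mcoef_munit eq_sym (negPf ki) mulr0.
rewrite mcoef_sum (bigD1 j) //= [X in _ + X]big1 ?addr0; last first.
  by move=> l lj; rewrite mcoefZ mcoef_munit (negPf lj) andbF mulr0.
by rewrite mcoefZ mcoef_munit !eqxx mulr1.
Qed.

Lemma munitM s (i j k l : 'I_(m s)) :
  (munit i j \o munit k l)%VF = (j == k)%:R *: munit i l.
Proof. by rewrite comp_lfunA munit_T -comp_lfunZl. Qed.

Lemma adj_munit s (i j : 'I_(m s)) : adj (munit i j) = munit j i.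
Proof. by rewrite /munit adj_comp adjK. Qed.

(** Cyclicity moves [T j] to the right end of the trace; the quotient of dimensions converts between
    normalization over [H] and over [W s]. *)
Lemma hs_dot_munit X s (i j : 'I_(m s)) :
  hs_dot X (munit i j) = hdim (W s) / hdim H * mcoef X i j.
Proof.
have d0 := irreducible_dim (sigma_irr s).
rewrite /hs_dot adj_munit -comp_lfunA ltraceC -comp_lfunA /mcoef mulrACA mulfV //.
by rewrite mul1r.
Qed.

Lemma T_isometric s (i : 'I_(m s)) w w' : '[T i w, T i w'] = '[w, w'].
Proof.
rewrite adjP; have /lfunP/(_ w') := T_orthonormal i i.
by rewrite eqxx scale1r comp_lfunE id_lfunE => ->.
Qed.

(** Tagged indices unite the two cases: different s by Schur, equal s by orthonormality. *)
Lemma tagged_ordP s (i : 'I_(m s)) t (j : 'I_(m t)) :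
  Tagged (fun s => 'I_(m s)) i != Tagged (fun s => 'I_(m s)) j ->
  (adj (T i) \o T j)%VF = 0.
Proof.
have [st|/T_orthogonal //] := eqVneq s t.
case: _ / st j => j; rewrite eq_Tagged /= => ij.
by rewrite T_orthonormal (negPf ij) scale0r.
Qed.

Lemma T_limg_orthogonal s (i : 'I_(m s)) t (j : 'I_(m t)) :
  Tagged (fun s => 'I_(m s)) i != Tagged (fun s => 'I_(m s)) j ->
  forall (w : W s) (w' : W t), '[T i w, T j w'] = 0.
Proof.
move=> ij w w'; rewrite adjP -comp_lfunE tagged_ordP // zero_lfunE.
by rewrite linear0r.
Qed.

Lemma munit_limg_id s (i : 'I_(m s)) v : v \in limg (T i) -> munit i i v = v.
Proof.
case/memv_imgP => w _ ->.
by rewrite -comp_lfunE munit_T eqxx scale1r.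
Qed.

Lemma munit_limg0 s (i j : 'I_(m s)) t (k : 'I_(m t)) v :
  Tagged (fun s => 'I_(m s)) j != Tagged (fun s => 'I_(m s)) k ->
  v \in limg (T k) -> munit i j v = 0.
Proof.
move=> ij /memv_imgP[w _ ->].
by rewrite -comp_lfunE -comp_lfunA tagged_ordP // comp_lfun0r zero_lfunE.
Qed.

Lemma sum_limg : (\sum_s \sum_i limg (@T s i))%VS = fullv.
Proof.
apply/eqP; rewrite eqEsubv subvf; apply/subvP => v _.
rewrite -[v]id_lfunE -T_complete sum_lfunE.
apply: memv_sumr => s _; rewrite sum_lfunE; apply: memv_sumr => i _.
by rewrite comp_lfunE memv_img ?memvf.
Qed.

Lemma directv_limg : directv (\sum_s \sum_i limg (@T s i)).
Proof.
apply/directv_sumE; split.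
  (* Inside one block, applying the diagonal unit at i to a vanishing sum isolates its i-th term. *)
  move=> s _; apply/directv_sum_independent => us hus us0 i _.
  have := congr1 (munit i i) us0; rewrite linear0 linear_sum (bigD1 i) //=.
  rewrite munit_limg_id ?hus // [X in _ + X]big1 ?addr0 // => j ji.
  apply: munit_limg0 (hus j isT); apply: contra ji.
  by rewrite eq_Tagged /= eq_sym.
apply/directv_sum_independent => us hus us0 s _.
(* Between blocks the same argument uses the projection onto the whole block of s. *)
pose P := \sum_(i < m s) munit i i.
have Ps : P (us s) = us s.
  have /memv_sumP[vs hvs ->] := hus s isT.
  rewrite linear_sum; apply: eq_bigr => i _; rewrite /= /P sum_lfunE (bigD1 i) //=.
  rewrite munit_limg_id ?hvs // big1 ?addr0 // => j ji.
  by apply: munit_limg0 (hvs i isT); rewrite eq_Tagged.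
have := congr1 P us0; rewrite linear0 linear_sum (bigD1 s) //= Ps.
rewrite [X in _ + X]big1 ?addr0 // => t ts.
have /memv_sumP[vs hvs ->] := hus t isT.
rewrite linear_sum big1 // => i _; rewrite /= /P sum_lfunE big1 // => j _.
apply: munit_limg0 (hvs i isT); apply/negP => /eqP/(congr1 tag) /= st.
by rewrite st eqxx in ts.
Qed.

Lemma munit_limg s (i j : 'I_(m s)) : (munit i j @: limg (T j))%VS = limg (T i).
Proof. by rewrite -limg_comp munit_T eqxx scale1r. Qed.

Lemma munit_lker s (i j : 'I_(m s)) : (lker (munit i j) :&: limg (T j))%VS = 0%VS.
Proof.
apply/eqP; rewrite -subv0; apply/subvP => v; rewrite memv_cap memv_ker memv0.
case/andP => /eqP k0 /munit_limg_id <-.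
(* On the image of [T j] the unit [munit j i] is a left inverse of [munit i j]. *)
have := munitM j i i j; rewrite eqxx scale1r => <-.
by rewrite comp_lfunE k0 linear0.
Qed.

Lemma munit_projection s (i : 'I_(m s)) :
  orthogonal_projection (munit i i) (limg (T i)).
Proof.
move=> v; split; first by rewrite comp_lfunE memv_img ?memvf.
move=> _ /memv_imgP[w _ ->].
rewrite linearBl /= -[munit i i](adjK) adj_munit adjPr -comp_lfunE munit_T.
by rewrite eqxx scale1r subrr.
Qed.

(** A vector w not killed by the i-th diagonal unit yields, through the i-th column of units, a
    basis of [M] in which [pi X] has matrix [mfourier X s]. *)
Lemma character_munit (M : vectType C) (pi : alg_rep A M) s (i : 'I_(m s)) :
  alg_irreducible pi -> pi (munit i i) != 0 ->
  is_character pi (fun X => \tr (mfourier X s)).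
Proof.
move=> [_ irr] /lfunPn[w]; rewrite zero_lfunE => w0.
pose v (j : 'I_(m s)) := pi (munit j i) w.
have piv X j : X \in A -> pi X (v j) = \sum_k mcoef X k j *: v k.
  move=> hX; rewrite -comp_lfunE -alg_actM ?munit_hom // comp_munit //.
  rewrite alg_act_sum => [|k]; last exact: munit_hom.
  by rewrite sum_lfunE; apply: eq_bigr => k _; rewrite scale_lfunE.
(* These operators read off the coefficient of [v k] as a multiple of the nonzero vector [v i],
   whence freeness. *)
have piUv k j : pi (munit i k) (v j) = (k == j)%:R *: v i.
  rewrite piv ?munit_hom // (bigD1 i) //= big1 ?addr0 => [|l li].
    by rewrite mcoef_munit eqxx.
  by rewrite mcoef_munit (negPf li) scale0r.
pose e := [tuple v j | j < m s].
have eE (j : 'I_(m s)) : e`_j = v j by rewrite -tnth_nth tnth_mktuple.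
have eP : basis_of fullv e.
  apply/andP; split; last first.
    apply/freeP => k k0 j; have := congr1 (pi (munit i j)) k0.
    rewrite linear0 linear_sum (bigD1 j) //= big1 ?addr0 => [|l lj].
      rewrite linearZ /= eE piUv eqxx scale1r => /eqP.
      by rewrite scaler_eq0 (negPf w0) orbF => /eqP.
    by rewrite linearZ /= eE piUv eq_sym (negPf lj) scale0r scaler0.
  have vi : v i \in <<e>>%VS by rewrite memv_span // -eE mem_nth ?size_tuple.
  (* The span is invariant and contains [v i], so irreducibility makes it all of [M]. *)
  have inv : {in A, forall X, (pi X @: <<e>> <= <<e>>)%VS}.
    move=> X hX; rewrite limg_span; apply/span_subvP => _ /mapP[_ /tnthP[j ->] ->].
    rewrite tnth_mktuple piv //; apply: memv_suml => k _.
    by rewrite memvZ // memv_span // -eE mem_nth ?size_tuple.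
  by have [e0|->] := irr _ inv; first by rewrite e0 memv0 (negPf w0) in vi.
move=> X hX; rewrite (ltrace_basis _ eP); apply: eq_bigr => j _.
rewrite mxE eE piv // linear_sum (bigD1 j) //= big1 ?addr0 => [|k kj].
  by rewrite linearZ /= -eE coord_free ?eqxx ?mulr1 ?(basis_free eP).
by rewrite linearZ /= -eE coord_free ?(basis_free eP) // (negPf kj) mulr0.
Qed.

(** The diagonal units add up to 1, so on a nonzero module one of them acts nontrivially, and
    [character_munit] applies to it. *)
Lemma irreducible_character_mfourier chi : irreducible_character A chi ->
  exists s, {in A, forall X, chi X = \tr (mfourier X s)}.
Proof.
move=> [M [pi [irr chiE]]].
suff [s [i Ui]] : exists s (i : 'I_(m s)), pi (munit i i) != 0.
  by exists s => X hX; rewrite chiE // (character_munit irr Ui).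
apply: contrapT => no; case: irr => + _; apply; apply/eqP; rewrite dimv_eq0.
apply/eqP/vspaceP => x; rewrite memvf memv0; apply/esym/eqP.
rewrite -[x]id_lfunE -(alg_act1 pi) -munit_complete.
(* The double sum is flattened to a single one with coefficients 1, the shape [alg_act_sum]
   accepts. *)
have -> : \sum_s \sum_(i < m s) munit i i =
    \sum_(p : {s : J & 'I_(m s)}) 1 *: munit (tagged p) (tagged p).
  by rewrite sig_big_dep /=; apply: eq_bigr => p _; rewrite scale1r.
rewrite alg_act_sum => [|p]; last exact: munit_hom.
rewrite big1 ?zero_lfunE // => -[s i] _ /=; rewrite scale1r.
by apply: contrapT => /eqP Ui; apply: no; exists s, i.
Qed.

Lemma hom_span s S : S \in homrep (sigma s) rho ->
  exists k : 'I_(m s) -> C, S = \sum_i k i *: T i.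
Proof.
move=> hS; exists (fun i => (hdim (W s))^-1 * ltrace (adj (T i) \o S)%VF).
rewrite [LHS]T_expand (bigD1 s) //= [X in _ + X]big1 ?addr0.
  apply: eq_bigr => i _.
  have := schur_scalar (sigma_irr s) (homrep_comp (adj_homrep (T_hom i)) hS).
  by move=> {1}->; rewrite -comp_lfunZr comp_lfun1r.
move=> t ts; apply: big1 => i _.
have st : s != t by rewrite eq_sym.
rewrite (inequivalent_hom0 (sigma_irr s) (sigma_irr t) (sigma_inequiv st)
  (homrep_comp (adj_homrep (T_hom i)) hS)).
by rewrite comp_lfun0r.
Qed.

Lemma lcomp_munit s (i j k : 'I_(m s)) :
  lcomp_rep (sigma s) rho (munit i j) (vsproj (homrep (sigma s) rho) (T k))
    = (j == k)%:R *: vsproj (homrep (sigma s) rho) (T i).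
Proof.
apply: subvs_inj; rewrite lcomp_actE ?munit_hom // linearZ /=.
by rewrite !vsprojK ?T_hom // munit_T.
Qed.

Lemma vsproj_T_neq0 s (i : 'I_(m s)) : vsproj (homrep (sigma s) rho) (T i) != 0.
Proof.
apply/negP => /eqP/(congr1 vsval); rewrite vsprojK ?T_hom // linear0 => T0.
have := T_orthonormal i i; rewrite T0 comp_lfun0r eqxx scale1r.
move=> /(congr1 (@ltrace _ _)).
rewrite ltrace0 ltrace1 => /esym/eqP; apply/negP.
exact: irreducible_dim (sigma_irr s).
Qed.

(** The [T i] span the module and the units permute them, so a nonzero vector generates everything.
    The index [i0] witnesses that the module is nonzero. *)
Lemma lcomp_irreducible s (i0 : 'I_(m s)) :
  alg_irreducible (lcomp_rep (sigma s) rho).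
Proof.
split.
  move/eqP; rewrite dimv_eq0 => /eqP h0; case/negP: (vsproj_T_neq0 i0).
  by rewrite -memv0 -h0 memvf.
move=> U Uinv; have [/eqP|] := eqVneq U 0%VS; first by left; apply/eqP.
rewrite -vpick0; set x := vpick U => x0; right.
have xU : x \in U := memv_pick U.
pose P := vsproj (homrep (sigma s) rho).
have span_P y : exists k : 'I_(m s) -> C, y = \sum_i k i *: P (T i).
  have [k kE] := hom_span (subvsP y); exists k.
  apply: subvs_inj; rewrite kE linear_sum; apply: eq_bigr => i _.
  by rewrite linearZ /= vsprojK ?T_hom.
have [k xE] := span_P x.
have [j kj] : exists j, k j != 0.
  apply: contrapT => no; case/negP: x0; rewrite xE big1 // => j _.
  have -> : k j = 0 by apply: contrapT => /eqP kj; apply: no; exists j.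
  by rewrite scale0r.
(* The unit at i, j sends [x] to [k j] times [P (T i)], and [k j] is invertible. *)
have TU i : P (T i) \in U.
  have : lcomp_rep (sigma s) rho (munit i j) x \in U.
    by apply: (subvP (Uinv _ (munit_hom i j))); rewrite memv_img.
  rewrite {1}xE linear_sum (bigD1 j) //= big1 ?addr0 => [|l lj].
    rewrite linearZ /= lcomp_munit eqxx scale1r => h.
    by rewrite -[P _]scale1r -(mulVf kj) -scalerA memvZ.
  by rewrite linearZ /= lcomp_munit eq_sym (negPf lj) scale0r scaler0.
apply/vspaceP => y; rewrite memvf; have [l ->] := span_P y.
by apply: memv_suml => i _; rewrite memvZ.
Qed.

Lemma lcomp_character s (i0 : 'I_(m s)) :
  is_character (lcomp_rep (sigma s) rho) (fun X => \tr (mfourier X s)).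
Proof.
apply: (@character_munit _ _ s i0); first exact: lcomp_irreducible i0.
apply/lfunPn; exists (vsproj (homrep (sigma s) rho) (T i0)).
by rewrite lcomp_munit eqxx scale1r zero_lfunE vsproj_T_neq0.
Qed.

End Decomposition.

(** * Dimension of the induced representation *)

Section InducedDimension.

Variables (C : numClosedFieldType) (G : finGroupType) (K : {group G}).
Variables (V : hspace C) (theta : urep K V).

Let I := {A : {set G} | A \in lcosets K [set: G]}.

Fact lcoset_in (g : G) : (g *: K)%g \in lcosets K [set: G].
Proof. by apply/lcosetsP; exists g. Qed.

Let cos (g : G) : I := exist _ (g *: K)%g (lcoset_in g).

Fact repr_cos g : (g^-1 * repr (val (cos g)))%g \in K.
Proof.
have /lcosetP[k Kk ->] : repr (g *: K)%g \in (g *: K)%g.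
  exact: mem_repr (lcoset_refl K g).
by rewrite mulKg.
Qed.

Fact cos_repr (c : I) : cos (repr (val c)) = c.
Proof.
apply: val_inj => /=; case: c => /= A /lcosetsP[g _ ->].
have /lcosetP[k Kk ->] : repr (g *: K)%g \in (g *: K)%g.
  exact: mem_repr (lcoset_refl K g).
by rewrite lcosetM lcoset_id.
Qed.

Fact cosM g k : k \in K -> cos (g * k)%g = cos g.
Proof. by move=> Kk; apply: val_inj; rewrite /= lcosetM lcoset_id. Qed.

Fact restrict_linear :
  linear (fun f : ind_space theta => [ffun c : I => vsval f (repr (val c))]).
Proof. by move=> a f1 f2; apply/ffunP => c; rewrite !ffunE. Qed.

(** An induced function is determined by its values at coset representatives, and these are
    arbitrary; restriction to them is therefore bijective. *)
Lemma ind_dim : hdim (ind_space theta) = hdim V * (#|[set: G] : K|%g)%:R.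
Proof.
have [phi phiE] := exists_lfun restrict_linear.
have phi0 : lker phi = 0%VS.
  apply: lker_eq0P => f f0; apply/val_inj/ffunP => g /=; rewrite ffunE.
  have kP := repr_cos g; set r := repr _ in kP.
  have -> : g = (r * (g^-1 * r)^-1)%g by rewrite invMg invgK mulVKg.
  have /ind_vsP -> := subvsP f; rewrite ?groupV //.
  have /ffunP/(_ (cos g)) : phi f = 0 := f0.
  by rewrite phiE !ffunE => ->; rewrite linear0.
have phi1 : limg phi = fullv.
  apply/vspaceP => h; rewrite memvf.
  (* The equivariant extension of [h]: with r the representative of the coset of g, write g as r
     times the inverse of [g^-1 * r], an element of [K]. *)
  pose F := [ffun g => theta (g^-1 * repr (val (cos g)))%g (h (cos g))].
  have hF : F \in ind_vs theta.
    apply/ind_vsP => g k Kk; rewrite !ffunE cosM // invMg -mulgA.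
    by rewrite Defs.actM ?groupV ?repr_cos // comp_lfunE.
  apply/memv_imgP; exists (vsproj _ F); rewrite ?memvf // phiE.
  apply/ffunP => c; rewrite ffunE vsprojK // ffunE cos_repr mulVg.
  by rewrite Defs.act1 id_lfunE.
have := @limg_dim_eq _ _ _ phi fullv; rewrite capfv phi0 phi1 => /(_ erefl) dE.
by rewrite /hdim -dE -natrM -card_lcosets -card_sig !dimvf mulnC.
Qed.

End InducedDimension.

(** * The diamond map: adjoints, scalar products and Frobenius reciprocity *)

Section Diamond.

Variables (C : numClosedFieldType) (G : finGroupType) (K : {group G}).
Variables (V : hspace C) (theta : urep K V).
Variables (W : hspace C) (sigma : urep [set: G]%G W).

Local Notation Ind := (ind_rep theta).
Local Notation HomK := (homrep theta (res_rep K sigma)).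

Let nrm : C := sqrtC (#|G|%:R * #|K|%:R).

Fact cardT_neq0 : #|G|%:R != 0 :> C.
Proof. by rewrite pnatr_eq0 -lt0n -cardsT (cardG_gt0 [set: G]%G). Qed.

Fact cardK_neq0 : #|K|%:R != 0 :> C.
Proof. by rewrite pnatr_eq0 -lt0n cardG_gt0. Qed.

Fact nrm_neq0 : nrm != 0.
Proof. by rewrite sqrtC_eq0 mulf_neq0 ?cardT_neq0 ?cardK_neq0. Qed.

Fact nrm_conj : nrm^* = nrm.
Proof. by apply: geC0_conj; rewrite sqrtC_ge0 -natrM ler0n. Qed.

Fact nrm_sqr : nrm * nrm = #|G|%:R * #|K|%:R.
Proof. by rewrite -expr2 sqrtCK. Qed.

Lemma diamondE L f : diamond theta sigma L f =
  nrm^-1 *: \sum_g sigma g (L (vsval f g)).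
Proof. by rewrite lfunE. Qed.

Lemma diamond_hom L : diamond theta sigma L \in homrep Ind sigma.
Proof.
apply/homrepP => x _; apply/lfunP => f; rewrite !comp_lfunE !diamondE.
rewrite linearZ linear_sum /=; congr (_ *: _).
rewrite [RHS](reindex_inj (mulgI x)); apply: eq_bigr => g _ /=.
by rewrite ind_actE mulKg Defs.actM ?inE // comp_lfunE.
Qed.

(** The right-hand side is checked to satisfy the adjoint identity. Its factor [#|K|] cancels the
    one in [ind_form], and the [K]-equivariance of [L] puts it in the induced space. *)
Lemma adj_diamondE L w g : L \in HomK ->
  vsval (adj (diamond theta sigma L) w) g =
    (#|K|%:R / nrm) *: adj L (sigma g^-1%g w).
Proof.
move=> hL; pose F w : {ffun G -> V} :=
  [ffun g => (#|K|%:R / nrm) *: adj L (sigma g^-1%g w)].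
have hF w' : F w' \in ind_vs theta.
  apply/ind_vsP => h k Kk; rewrite !ffunE invMg Defs.actM ?inE // linearZ /=.
  congr (_ *: _); have /homrepP hL' := adj_homrep hL.
  have /lfunP/(_ (sigma h^-1%g w')) := hL' k^-1%g (groupVr Kk).
  by rewrite !comp_lfunE => ->.
have FL : linear (fun w => vsproj (ind_vs theta) (F w)).
  move=> a w1 w2; rewrite -linearP; congr (vsproj _ _); apply/ffunP => h.
  by rewrite !ffunE linearP linearP /= linearP.
have [S SE] := exists_lfun FL.
have -> : adj (diamond theta sigma L) = S; last by rewrite SE vsprojK // ffunE.
apply: adj_unique => f w'.
rewrite diamondE linearZl_LR linear_sumlz mulr_sumr /= /ind_form mulr_sumr.
apply: eq_bigr => h _; rewrite SE vsprojK // ffunE linearZr_LR /=.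
rewrite rmorphM fmorphV rmorph_nat /= nrm_conj mulrA mulKf ?cardK_neq0 //.
by congr (_ * _); rewrite -adjP -[RHS]adjPr act_adj ?inE // invgK.
Qed.

Lemma diamond_adj_sum L1 L2 : L2 \in HomK ->
  (diamond theta sigma L1 \o adj (diamond theta sigma L2))%VF =
  #|G|%:R^-1 *: \sum_g (sigma g \o ((L1 \o adj L2) \o sigma g^-1%g))%VF.
Proof.
move=> hL; apply/lfunP => w; rewrite comp_lfunE diamondE scale_lfunE sum_lfunE.
rewrite !scaler_sumr; apply: eq_bigr => g _.
rewrite adj_diamondE // !comp_lfunE !linearZ /= scalerA; congr (_ *: _).
(* The constants combine to [#|K|] over the square of [nrm], that is [#|G|^-1]: the product is a
   genuine average over the group. *)
rewrite -mulrA -invfM nrm_sqr invfM mulrCA mulfV ?cardK_neq0 ?mulr1 //.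
Qed.

(** By Schur only the trace is to be found, and conjugation by [sigma g] gives every term of the
    average the same trace. *)
Lemma diamond_adj_diamond L1 L2 : hdim V != 0 -> irreducible sigma ->
  L2 \in HomK ->
  (diamond theta sigma L1 \o adj (diamond theta sigma L2))%VF =
  (hdim V / hdim W * hs_dot L1 L2) *: \1%VF.
Proof.
move=> V0 irr hL2.
have hh := homrep_comp (diamond_hom L1) (adj_homrep (diamond_hom L2)).
rewrite [LHS](schur_scalar irr hh) diamond_adj_sum // ltraceZ; congr (_ *: _).
have -> : ltrace (\sum_g (sigma g \o ((L1 \o adj L2) \o sigma g^-1%g))%VF)
    = \sum_(g : G) ltrace (L1 \o adj L2)%VF.
  rewrite (big_morph _ (@ltraceD _ _) (ltrace0 _)); apply: eq_bigr => g _.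
  rewrite ltraceC -comp_lfunA -Defs.actM ?inE // mulVg Defs.act1.
  by rewrite comp_lfun1r.
rewrite sumr_const ltraceC -[ltrace _ *+ _]mulr_natl mulKf ?cardT_neq0 //.
by rewrite /hs_dot mulrC mulrAC [_ / _]mulrC mulrCA mulKf // mulrC.
Qed.

(** The embedding of [V] in the induced space as the functions supported on [K]; [point v] takes the
    value [v] at 1. *)
Let point (v : V) : {ffun G -> V} :=
  [ffun g => if g \in K then theta g^-1%g v else 0].

Fact point_ind v : point v \in ind_vs theta.
Proof.
apply/ind_vsP => g k Kk; rewrite !ffunE groupMr //.
case: ifP => Kg; last by rewrite linear0.
by rewrite invMg Defs.actM ?groupV // comp_lfunE.
Qed.

Fact point_linear : linear (fun v => vsproj (ind_vs theta) (point v)).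
Proof.
move=> a v1 v2; rewrite -linearP; congr (vsproj _ _); apply/ffunP => g.
by rewrite !ffunE; case: ifP => _; rewrite ?linearP // scaler0 addr0.
Qed.

Lemma frobenius_reciprocity S : S \in homrep Ind sigma ->
  exists2 L, L \in HomK & S = diamond theta sigma L.
Proof.
move=> hS; have [E EE] := exists_lfun point_linear.
have SE g f : sigma g (S f) = S (Ind g f).
  by have /homrepP/(_ g (in_setT g))/lfunP/(_ f) := hS; rewrite !comp_lfunE.
have K0 := cardK_neq0.
(* [L] is the restriction of [S] to the embedded copy of [V]; the scalar cancels [nrm^-1] in the
   diamond and the [#|K|]-fold count in [fE]. *)
exists ((nrm / #|K|%:R) *: (S \o E)%VF).
  rewrite memvZ //; apply/homrepP => k Kk; apply/lfunP => v.
  rewrite !comp_lfunE SE; congr (S _); rewrite !EE.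
  apply/val_inj/ffunP => g /=; rewrite ind_actE !vsprojK ?point_ind // !ffunE.
  rewrite groupMl ?groupV //; case: ifP => // Kg.
  by rewrite invMg invgK Defs.actM ?groupV // comp_lfunE.
apply/lfunP => f; rewrite diamondE.
(* At x exactly the g in the coset of x contribute, each with the value of [f] at x. *)
have fE : f = #|K|%:R^-1 *: \sum_g Ind g (E (vsval f g)).
  apply/val_inj/ffunP => x; rewrite linearZ linear_sum /= ffunE sum_ffunE.
  have -> : \sum_g (vsval (ind_act theta g (E (vsval f g)))) x
      = \sum_(k in K) vsval f x.
    rewrite (reindex_inj (mulgI x)) [RHS]big_mkcond /=.
    apply: eq_bigr => k _; rewrite ind_actE EE vsprojK ?point_ind // ffunE.
    rewrite invMg mulgKV groupV; case: ifP => // Kk.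
    have /ind_vsP -> // := subvsP f.
    by rewrite invgK -comp_lfunE -Defs.actM ?groupV // mulgV Defs.act1 id_lfunE.
  by rewrite sumr_const -scaler_nat scalerA mulVf // scale1r.
rewrite {1}fE linearZ linear_sum /= !scaler_sumr; apply: eq_bigr => g _.
rewrite scale_lfunE linearZ /= scalerA mulKf ?nrm_neq0 // comp_lfunE SE //.
Qed.

End Diamond.

(** * Invariant subspaces as unitary representations *)

Section Subrepresentation.

Variables (C : numClosedFieldType) (G : finGroupType) (D : {group G}).
Variables (H : hspace C) (rho : urep D H) (U : {vspace H}).

Definition sub_form (x y : subvs_of U) : C := '[vsval x, vsval y].

Fact sub_form_bilinear : bilinear_for *%R (Num.conj \; *%R) sub_form.
Proof.
split=> [v c u1 u2|u c v1 v2] /=; rewrite /sub_form [vsval (_ + _)]linearP /=.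
  by rewrite linearDl linearZl_LR.
by rewrite linearDr linearZr_LR.
Qed.
HB.instance Definition _ :=
  bilinear_isBilinear.Build _ _ _ _ _ _ sub_form sub_form_bilinear.

Fact sub_form_herm x y :
  sub_form x y = (-1) ^+ false * Num.conj (sub_form y x).
Proof. exact: hermC. Qed.
HB.instance Definition _ :=
  isHermitianSesquilinear.Build _ _ _ _ sub_form sub_form_herm.

Fact sub_form_gt0 x : x != 0 -> 0 < sub_form x x.
Proof. by move=> x0; rewrite dnorm_gt0. Qed.
HB.instance Definition _ := isDotProduct.Build _ _ sub_form sub_form_gt0.

Definition sub_space : hspace C := @HSpace C (subvs_of U) sub_form.

Hypothesis Uinv : Defs.invariant rho U.

Definition sub_act (g : G) : 'End(sub_space) :=
  linfun (vsproj U \o rho g \o vsval).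

Fact sub_actE g (x : sub_space) : g \in D -> vsval (sub_act g x) = rho g (vsval x).
Proof.
move=> Dg; rewrite lfunE /= vsprojK //.
by apply: (subvP (Uinv Dg)); rewrite memv_img ?subvsP.
Qed.

Fact sub_act1 : sub_act 1%g = \1%VF.
Proof.
by apply/lfunP => x; apply: subvs_inj; rewrite sub_actE // Defs.act1 !id_lfunE.
Qed.

Fact sub_actM :
  {in D &, forall x y, sub_act (x * y)%g = (sub_act x \o sub_act y)%VF}.
Proof.
move=> x y Dx Dy; apply/lfunP => u; apply: subvs_inj.
by rewrite comp_lfunE !sub_actE ?groupM // Defs.actM // comp_lfunE.
Qed.

Fact sub_unitary :
  {in D, forall x (u v : sub_space), '[sub_act x u, sub_act x v] = '[u, v]}.
Proof.
by move=> x Dx u v; rewrite /= /sub_form !sub_actE // (act_unitary rho).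
Qed.

(** Completeness of the list of irreducibles is a statement about representations on Hermitian
    spaces, so an irreducible subspace has to become one. *)
Definition sub_rep : urep D sub_space := URep sub_act1 sub_actM sub_unitary.

Definition sub_incl : 'Hom(sub_space, H) := linfun vsval.

Lemma sub_incl_hom : sub_incl \in homrep sub_rep rho.
Proof.
apply/homrepP => g Dg; apply/lfunP => x.
rewrite !comp_lfunE [sub_incl x]lfunE [in RHS]lfunE /=.
by rewrite sub_actE.
Qed.

Lemma adj_sub_incl : (adj sub_incl \o sub_incl)%VF = \1%VF.
Proof.
apply/lfunP => x; apply: form_inj => y.
by rewrite comp_lfunE -adjP id_lfunE [sub_incl y]lfunE [sub_incl x]lfunE.
Qed.

Lemma sub_incl_limg : limg sub_incl = U.
Proof.
apply/eqP; rewrite eqEsubv; apply/andP; split; apply/subvP => v.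
  by case/memv_imgP => x _ ->; rewrite lfunE subvsP.
move=> vU; apply/memv_imgP; exists (vsproj U v); rewrite ?memvf //.
by rewrite lfunE /= vsprojK.
Qed.

Lemma sub_rep_contained : contained sub_rep rho.
Proof.
exists U => //; exists sub_incl; split.
- exact: sub_incl_hom.
- apply: lker_eq0P => x; rewrite lfunE /= => x0.
  by apply: subvs_inj; rewrite x0 linear0.
- exact: sub_incl_limg.
Qed.

Lemma sub_rep_irreducible : irreducible_on rho U -> irreducible sub_rep.
Proof.
move=> [U0 _ irr]; split.
- move=> f0; apply: U0; rewrite -sub_incl_limg f0; exact: limg0.
- by move=> g Dg; apply: subvf.
move=> X _ Xinv.
have XU : (sub_incl @: X <= U)%VS.
  by rewrite -[X in (_ <= X)%VS]sub_incl_limg limgS ?subvf.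
have Xinv' : Defs.invariant rho (sub_incl @: X).
  move=> g Dg; apply/subvP => _ /memv_imgP[_ /memv_imgP[x xX ->] ->].
  have /homrepP/(_ g Dg)/lfunP/(_ x) := sub_incl_hom; rewrite !comp_lfunE => ->.
  by rewrite memv_img //; apply: (subvP (Xinv g Dg)); rewrite memv_img.
have k0 : lker sub_incl == 0%VS.
  apply/eqP/lker_eq0P => x; rewrite lfunE /= => x0.
  by apply: subvs_inj; rewrite x0 linear0.
have [X0|XE] := irr _ XU Xinv'; [left|right].
  by apply/eqP; rewrite -subv0 -(limg_ker0 _ _ k0) X0 sub0v.
by apply/eqP; rewrite eqEsubv subvf -(limg_ker0 _ _ k0) XE sub_incl_limg subvv.
Qed.

End Subrepresentation.

(** * Resolution of the identity from a complete list of irreducibles *)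

Section Completeness.

Variables (C : numClosedFieldType) (G : finGroupType) (D : {group G}).
Variables (H : hspace C) (rho : urep D H).

Lemma exists_irreducible_sub (U : {vspace H}) :
  U <> 0%VS -> Defs.invariant rho U ->
  exists2 U' : {vspace H}, (U' <= U)%VS & irreducible_on rho U'.
Proof.
have [n] := ubnP (\dim U); elim: n U => // n IH U /ltnSE Un U0 Uinv.
have [irr|red] := pselect (irreducible_on rho U); first by exists U.
have [X [XU Xinv X0 XNU]] : exists X : {vspace H},
    [/\ (X <= U)%VS, Defs.invariant rho X, X <> 0%VS & X <> U].
  apply: contrapT => no; apply: red; split=> // X XU Xinv.
  apply: contrapT => /not_orP[X0 XNU]; apply: no; by exists X.
have [|Y YX irr] := IH X _ X0 Xinv; last by exists Y => //; exact: subv_trans XU.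
apply: leq_trans Un; rewrite ltn_neqAle dimvS // andbT.
by rewrite (dimv_leqif_eq XU); apply/eqP.
Qed.

Lemma hom_span_complete (J : finType) (W : J -> hspace C)
    (sigma : forall s, urep D (W s)) (m : J -> nat)
    (T : forall s, 'I_(m s) -> 'Hom(W s, H)) :
  (forall (W' : hspace C) (sigma' : urep D W'),
     irreducible sigma' -> contained sigma' rho ->
     exists s, equivalent sigma' (sigma s)) ->
  (forall s i, T s i \in homrep (sigma s) rho) ->
  (forall s (i j : 'I_(m s)), (adj (T s i) \o T s j)%VF = (i == j)%:R *: \1%VF) ->
  (forall s t (i : 'I_(m s)) (j : 'I_(m t)), s != t ->
     (adj (T s i) \o T t j)%VF = 0) ->
  (forall s S, S \in homrep rho (sigma s) ->
     exists k : 'I_(m s) -> C, S = \sum_i k i *: adj (T s i)) ->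
  \sum_s \sum_(i < m s) (T s i \o adj (T s i))%VF = \1%VF.
Proof.
move=> Jcomplete Thom Torth Torth0 Tspan; set P := \sum_s _.
have TP s i : (adj (T s i) \o P)%VF = adj (T s i).
  rewrite comp_lfun_sumr (bigD1 s) //= [X in _ + X]big1 ?addr0 => [|t ts].
    rewrite comp_lfun_sumr (bigD1 i) //= [X in _ + X]big1 ?addr0 => [|j ji].
      by rewrite comp_lfunA Torth eqxx scale1r comp_lfun1l.
    by rewrite comp_lfunA Torth eq_sym (negPf ji) scale0r comp_lfun0l.
  rewrite comp_lfun_sumr big1 // => j _.
  by rewrite comp_lfunA Torth0 ?comp_lfun0l // eq_sym.
have hP : P \in homrep rho rho.
  apply: memv_suml => s _; apply: memv_suml => i _.
  exact: homrep_comp (Thom s i) (adj_homrep (Thom s i)).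
(* The kernel of [P] is the orthogonal complement of the sum of the images. *)
have hK : Defs.invariant rho (lker P) := lker_invariant hP.
have kP0 : lker P = 0%VS.
  apply: contrapT => kP.
  have [U UK irr] := exists_irreducible_sub kP hK.
  have Uinv : Defs.invariant rho U by case: irr.
  have irr' := sub_rep_irreducible Uinv irr.
  have [s [E [hE kE _]]] := Jcomplete _ _ irr' (sub_rep_contained Uinv).
  have hS := homrep_comp hE (adj_homrep (sub_incl_hom Uinv)).
  have [k SE] := Tspan s _ hS.
  have PI : (P \o sub_incl U)%VF = 0.
    apply/lfunP => x; rewrite comp_lfunE zero_lfunE; apply/eqP.
    by rewrite -memv_ker (subvP UK) // lfunE subvsP.
  (* A combination of the adjoints of the [T s i] is unchanged by [P], while [P] vanishes on [U];
     together these force the equivalence [E] to be zero. *)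
  have SP : ((E \o adj (sub_incl U)) \o P)%VF = (E \o adj (sub_incl U))%VF.
    rewrite SE comp_lfun_suml; apply: eq_bigr => i _.
    by rewrite -comp_lfunZl TP.
  have E0 : E = 0.
    rewrite -[E]comp_lfun1r -(adj_sub_incl U) comp_lfunA -SP -comp_lfunA PI.
    by rewrite comp_lfun0r.
  case: irr' => + _ _; apply; rewrite -kE E0; apply/vspaceP => x.
  by rewrite memv_ker zero_lfunE eqxx memvf.
(* An injective idempotent is the identity. *)
have PP : (P \o P)%VF = P.
  rewrite {1}/P comp_lfun_suml; apply: eq_bigr => s _.
  by rewrite comp_lfun_suml; apply: eq_bigr => i _; rewrite -comp_lfunA TP.
have Pinj : injective P by apply/lker0P; rewrite kP0.
apply/lfunP => x; apply: Pinj.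
by rewrite -comp_lfunE PP id_lfunE.
Qed.

End Completeness.

Lemma hs_dot_linear (C : numClosedFieldType) (A B : hspace C) (Y : 'Hom(A, B)) :
  linear_for *%R (@hs_dot C A B ^~ Y).
Proof.
move=> a X1 X2; rewrite /hs_dot comp_lfunDr -comp_lfunZr ltraceD ltraceZ.
by rewrite mulrDr mulrCA.
Qed.

Lemma hs_dotZr (C : numClosedFieldType) (A B : hspace C) a (X Y : 'Hom(A, B)) :
  hs_dot X (a *: Y) = a^* * hs_dot X Y.
Proof. by rewrite /hs_dot adj_lfunZ -comp_lfunZl ltraceZ mulrCA. Qed.

(** * Application to the induced representation *)

Section InducedFourier.

Variables (C : numClosedFieldType) (G : finGroupType) (K : {group G}).
Variables (V : hspace C) (theta : urep K V) (J : finType) (W : J -> hspace C).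
Variables (sigma : forall s, urep [set: G]%G (W s)) (m : J -> nat).
Variable L : forall s, 'I_(m s) -> 'Hom(V, W s).

Local Notation Ind := (ind_rep theta).
Local Notation EndG := (homrep Ind Ind).
Local Notation T := (fun s => Top theta (sigma s) (@L s)).

Hypothesis theta_irr : irreducible theta.
Hypothesis sigma_irr : forall s, irreducible (sigma s).
Hypothesis sigma_inequiv :
  forall s t, s != t -> ~ equivalent (sigma s) (sigma t).
Hypothesis sigma_contained : forall s, contained (sigma s) Ind.
Hypothesis sigma_complete :
  forall (W' : hspace C) (sigma' : urep [set: G]%G W'),
    irreducible sigma' -> contained sigma' Ind ->
    exists s, equivalent sigma' (sigma s).
Hypothesis L_basis : forall s, orthonormal_basis (@hs_dot _ V (W s))
  (homrep theta (res_rep K (sigma s))) (@L s).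

Fact hdimV_neq0 : hdim V != 0.
Proof. exact: irreducible_dim theta_irr. Qed.

Fact hdimW_neq0 s : hdim (W s) != 0.
Proof. exact: irreducible_dim (sigma_irr s). Qed.

Fact sqrt_ratio_conj s :
  (sqrtC (hdim (W s) / hdim V))^* = sqrtC (hdim (W s) / hdim V).
Proof. by apply: geC0_conj; rewrite sqrtC_ge0 divr_ge0 ?ler0n. Qed.

Lemma L_hom s i : @L s i \in homrep theta (res_rep K (sigma s)).
Proof. by have [/basis_mem-> //] := L_basis s; exact: codom_f. Qed.

Lemma adj_Top s i :
  adj (T s i) = sqrtC (hdim (W s) / hdim V) *: diamond theta (sigma s) (L i).
Proof. by rewrite /Top adj_lfunZ adjK sqrt_ratio_conj. Qed.

Lemma Uop_munit s i j : Uop theta (sigma s) (@L s) i j = munit T i j.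
Proof.
rewrite /munit adj_Top /Top /Uop -comp_lfunZl -comp_lfunZr scalerA.
by rewrite -expr2 sqrtCK.
Qed.

Lemma Top_hom s i : T s i \in homrep (sigma s) Ind.
Proof. by rewrite memvZ // adj_homrep // diamond_hom. Qed.

(** The square root in [Top], squared, cancels the quotient of dimensions in
    [diamond_adj_diamond]. *)
Lemma Top_orthonormal s (i j : 'I_(m s)) :
  (adj (T s i) \o T s j)%VF = (i == j)%:R *: \1%VF.
Proof.
rewrite adj_Top /Top -comp_lfunZl -comp_lfunZr scalerA -expr2 sqrtCK.
rewrite (diamond_adj_diamond _ hdimV_neq0 (sigma_irr s) (L_hom _)).
have [_ ->] := L_basis s; rewrite scalerA mulrA -[hdim V / _]invf_div.
by rewrite mulfV ?mul1r // mulf_neq0 ?invr_neq0 ?hdimV_neq0 ?hdimW_neq0.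
Qed.

Lemma Top_orthogonal s t (i : 'I_(m s)) (j : 'I_(m t)) :
  s != t -> (adj (T s i) \o T t j)%VF = 0.
Proof.
move=> st; have ts : t != s by rewrite eq_sym.
apply: (inequivalent_hom0 (sigma_irr t) (sigma_irr s) (sigma_inequiv ts)).
exact: homrep_comp (adj_homrep (Top_hom _)) (Top_hom _).
Qed.

Lemma diamondZ s c (S : 'Hom(V, W s)) :
  diamond theta (sigma s) (c *: S) = c *: diamond theta (sigma s) S.
Proof.
apply/lfunP => f; rewrite scale_lfunE !diamondE scalerA [c * _]mulrC -scalerA.
congr (_ *: _); rewrite scaler_sumr; apply: eq_bigr => g _.
by rewrite scale_lfunE linearZ.
Qed.

Lemma diamond_sum s (I : finType) (F : I -> 'Hom(V, W s)) :
  diamond theta (sigma s) (\sum_i F i) = \sum_i diamond theta (sigma s) (F i).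
Proof.
apply/lfunP => f; rewrite sum_lfunE.
rewrite diamondE; under [RHS]eq_bigr do rewrite diamondE.
rewrite -scaler_sumr [in RHS]exchange_big /=; congr (_ *: _).
by apply: eq_bigr => g _; rewrite sum_lfunE linear_sum.
Qed.

Lemma adj_Top_span s S : S \in homrep Ind (sigma s) ->
  exists k : 'I_(m s) -> C, S = \sum_i k i *: adj (T s i).
Proof.
move=> /frobenius_reciprocity[S' hS' ->]; have [Lb _] := L_basis s.
have S'E := coord_basis (X := codom_tuple (@L s)) Lb hS'.
pose r := sqrtC (hdim (W s) / hdim V).
have r0 : r != 0.
  by rewrite sqrtC_eq0 mulf_neq0 ?invr_neq0 ?hdimV_neq0 ?hdimW_neq0.
(* Coordinates along [codom] are indexed by the enumeration of the index type; dividing by [r]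
   undoes the scaling of [Top]. *)
pose k (i : 'I_#|'I_(m s)|) := coord (codom_tuple (@L s)) i S'.
exists (fun i => k (enum_rank i) / r).
rewrite {1}S'E diamond_sum (reindex (@enum_rank 'I_(m s))) /=; last first.
  by apply: onW_bij; apply: enum_rank_bij.
apply: eq_bigr => i _; rewrite diamondZ adj_Top scalerA divfK //.
congr (_ *: diamond _ _ _).
rewrite /codom /image_mem (nth_map i) -?cardE ?ltn_ord //.
by rewrite nth_enum_rank.
Qed.

Lemma Top_complete : \sum_s \sum_(i < m s) (T s i \o adj (T s i))%VF = \1%VF.
Proof.
apply: (hom_span_complete sigma_complete (T := T)).
- exact: Top_hom.
- exact: Top_orthonormal.
- by move=> s t i j; apply: Top_orthogonal.
- exact: adj_Top_span.
Qed.

Lemma index_neq0 : (#|[set: G] : K|%g)%:R != 0 :> C.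
Proof. by rewrite pnatr_eq0 -lt0n indexg_gt0. Qed.

Lemma hdim_ind_neq0 : hdim (ind_space theta) != 0.
Proof. by rewrite ind_dim mulf_neq0 ?hdimV_neq0 ?index_neq0. Qed.

(** By [ind_dim] the prefactor is [hdim (ind_space theta)] over [hdim (W s)], the inverse of the
    factor in [hs_dot_munit]. *)
Lemma fourierE s X i j : fourier (sigma s) (@L s) X i j = mcoef T X i j.
Proof.
rewrite mxE Uop_munit (hs_dot_munit _ sigma_irr) -(ind_dim theta) mulrA.
rewrite -[hdim _ / _]invf_div.
by rewrite mulVf ?mul1r // mulf_neq0 ?invr_neq0 ?hdim_ind_neq0 ?hdimW_neq0.
Qed.

Lemma fourier_mfourier s X : fourier (sigma s) (@L s) X = mfourier T X s.
Proof. by apply/matrixP => i j; rewrite fourierE [RHS]mxE. Qed.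

(** Containment gives an injective intertwiner from the nonzero [W s]; it is a combination of the
    [T s i], so there is at least one of them. *)
Lemma multiplicity_gt0 s : (0 < m s)%N.
Proof.
rewrite lt0n; apply/negP => /eqP m0.
have [U _ [S [hS kS _]]] := sigma_contained s.
have [k SE] := hom_span sigma_irr sigma_inequiv Top_hom Top_complete hS.
have [+ _ _] := sigma_irr s; apply; rewrite -kS; apply/vspaceP => x.
rewrite memvf memv_ker SE sum_lfunE big1 ?eqxx // => i _.
by have := ltn_ord i; rewrite [X in (_ < X)%N]m0.
Qed.

Lemma Uop_orthonormal_basis :
  orthonormal_basis (@hs_dot _ (ind_space theta) (ind_space theta)) EndG
    (fun p : {s : J & ('I_(m s) * 'I_(m s))%type} =>
       sqrtC (hdim V * (#|[set: G] : K|%g)%:R / hdim (W (tag p)))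
         *: Uop theta (sigma (tag p)) (@L (tag p)) (tagged p).1 (tagged p).2).
Proof.
rewrite -(ind_dim theta); set b := (X in orthonormal_basis _ _ X).
pose r s := sqrtC (hdim (ind_space theta) / hdim (W s)).
have r0 s : r s != 0.
  by rewrite sqrtC_eq0 mulf_neq0 ?invr_neq0 ?hdim_ind_neq0 ?hdimW_neq0.
have rr s : (r s)^* = r s.
  by apply: geC0_conj; rewrite sqrtC_ge0 divr_ge0 ?ler0n.
have bE p : b p = r (tag p) *: munit T (tagged p).1 (tagged p).2.
  by rewrite /b Uop_munit.
have dotb p q : hs_dot (b p) (b q) = (p == q)%:R.
  rewrite !bE hs_dotZr rr -[r (tag p) *: _]addr0 hs_dot_linear.
  have -> Y : hs_dot (0 : 'End(ind_space theta)) Y = 0.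
    by rewrite /hs_dot comp_lfun0r ltrace0 mulr0.
  rewrite addr0 (hs_dot_munit _ sigma_irr); case: p q => [s [i j]] [t [k l]] /=.
  have [st|st] := eqVneq s t; last first.
    rewrite (mcoef_munit0 sigma_irr sigma_inequiv Top_hom) // !mulr0.
    by case: eqP => // /(congr1 tag) /= /eqP; rewrite (negPf st).
  case: _ / st k l => k l.
  rewrite (mcoef_munit sigma_irr Top_orthonormal) eq_Tagged /=.
  rewrite xpair_eqE [k == i]eq_sym !mulrA [r s * r s]mulrC -expr2 sqrtCK.
  rewrite -[_ / hdim (W s)]invf_div -!mulrA.
  rewrite [hdim (W s) * _]mulrA mulKf //.
  by rewrite mulf_neq0 ?invr_neq0 ?hdim_ind_neq0 ?hdimW_neq0.
split=> //; apply: (codom_basis (@hs_dot_linear _ _ _)) => //.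
  by move=> p; rewrite bE memvZ // (munit_hom Top_hom).
(* The inversion formula, with its coefficients rescaled to the normalized units. *)
move=> X hX; exists (fun p => mcoef T X (tagged p).1 (tagged p).2 / r (tag p)).
rewrite [LHS](munit_inversion sigma_irr sigma_inequiv Top_hom Top_complete hX).
under eq_bigr do rewrite pair_big.
rewrite sig_big_dep /=; apply: eq_bigr => p _.
by rewrite bE scalerA divfK.
Qed.

End InducedFourier.

Theorem theorem4p3 (R : realType) (G : finGroupType) (K : {group G})
    (V : hspace R[i]) (theta : urep K V)
    (J : finType) (W : J -> hspace R[i])
    (sigma : forall s, urep [set: G]%G (W s))
    (m : J -> nat) (L : forall s, 'I_(m s) -> 'Hom(V, W s)) :
  let Ind := ind_rep theta in
  let EndG := homrep Ind Ind in
  let U s := Uop theta (sigma s) (L s) in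
  let T s := Top theta (sigma s) (L s) in
  let FT (X : 'End(ind_space theta)) s := fourier (sigma s) (L s) X in
  irreducible theta ->
  (forall s, irreducible (sigma s)) ->
  (forall s t, s != t -> ~ equivalent (sigma s) (sigma t)) ->
  (forall s, contained (sigma s) Ind) ->
  (forall (W' : hspace R[i]) (sigma' : urep [set: G]%G W'),
     irreducible sigma' -> contained sigma' Ind ->
     exists s, equivalent sigma' (sigma s)) ->
  (forall s, multiplicity (sigma s) Ind (m s)) ->
  (forall s, orthonormal_basis (@hs_dot _ V (W s))
               (homrep theta (res_rep K (sigma s))) (L s)) ->
  (* (1) *)
  (orthonormal_basis (@hs_dot _ (ind_space theta) (ind_space theta)) EndG
     (fun p : {s : J & ('I_(m s) * 'I_(m s))%type} =>
        sqrtC (hdim V * (#|[set: G] : K|%g)%:R / hdim (W (tag p)))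
          *: U (tag p) (tagged p).1 (tagged p).2)
   /\ {in EndG, forall X,
         X = \sum_s \sum_i \sum_j FT X s i j *: U s i j})
  (* (2) *)
  /\ [/\ forall s i, T s i \in homrep (sigma s) Ind,
         forall s i w w', '[T s i w, T s i w'] = '[w, w'],
         forall s i t j,
           Tagged (fun s => 'I_(m s)) i != Tagged (fun s => 'I_(m s)) j ->
           forall (w : W s) (w' : W t), '[T s i w, T t j w'] = 0,
         (\sum_s \sum_i limg (T s i))%VS = fullv
           /\ directv (\sum_s \sum_i limg (T s i))
       & matrix_alg_isomorphism EndG FT]
  (* (3) *)
  /\ (forall s i j,
        [/\ U s i j \in EndG,
            (U s i j @: limg (T s j))%VS = limg (T s i)
          & (lker (U s i j) :&: limg (T s j))%VS = 0%VS])
  (* (4) *)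
  /\ (forall s i, orthogonal_projection (U s i i) (limg (T s i)))
  (* (5) *)
  /\ ((forall s, alg_irreducible (lcomp_rep (sigma s) Ind)
         /\ is_character (lcomp_rep (sigma s) Ind) (fun X => \tr (FT X s)))
      /\ forall chi : 'End(ind_space theta) -> R[i],
           irreducible_character EndG chi <->
           exists s, {in EndG, forall X, chi X = \tr (FT X s)}).
Proof.
move=> Ind EndG U T FT irrV irrW ineq cont compl _ Lb.
have Th : forall s i, T s i \in homrep (sigma s) Ind by move=> s i; exact: Top_hom.
have To := Top_orthonormal irrV irrW Lb.
have Tc := Top_complete irrV irrW ineq compl Lb.
have UE s i j : U s i j = munit T i j by exact: Uop_munit.
have FE X s : FT X s = mfourier T X s by exact: fourier_mfourier.
have m0 s : (0 < m s)%N := multiplicity_gt0 irrV irrW ineq cont compl Lb s.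
split; last split; last split; last split; last split.
- split; first exact: Uop_orthonormal_basis irrV irrW ineq compl Lb.
  move=> X hX; rewrite [LHS](munit_inversion irrW ineq Th Tc hX).
  apply: eq_bigr => s _; apply: eq_bigr => i _; apply: eq_bigr => j _.
  by rewrite UE FE mxE.
- split.
  + exact: Th.
  + by move=> s i w w'; rewrite (T_isometric To).
  + by move=> s i t j ij w w'; rewrite (T_limg_orthogonal irrW ineq Th To).
  + split; first exact: sum_limg Tc.
    exact: directv_limg irrW ineq Th To.
  (* The isomorphism predicate takes the whole map as argument, so the entrywise identity is first
     made an equality of functions. *)
  + have -> : FT = mfourier T.
      by apply/funext => X; apply/functional_extensionality_dep => s.
    exact: mfourier_iso irrW ineq Th To Tc.
- move=> s i j; rewrite UE; split.
  + exact: munit_hom Th _ _ _.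
  + exact: munit_limg To _ _ _.
  + exact: munit_lker To _ _ _.
- by move=> s i; rewrite UE; apply: munit_projection To _ _.
- move=> s; pose i := Ordinal (m0 s); split.
    exact: (lcomp_irreducible irrW ineq Th To Tc i).
  move=> X hX; rewrite /= FE.
  exact: (lcomp_character irrW ineq Th To Tc i hX).
move=> chi; split.
  move=> /(irreducible_character_mfourier irrW ineq Th To Tc)[s chiE].
  by exists s => X hX; rewrite chiE // FE.
(* Conversely, the trace at s is realized by left composition on the intertwiners from [W s]; [i]
   certifies that this module is nonzero. *)
move=> [s chiE]; pose i := Ordinal (m0 s).
exists _, (lcomp_rep (sigma s) Ind).
split; first exact: (lcomp_irreducible irrW ineq Th To Tc i).
move=> X hX; rewrite chiE // FE.
exact: (lcomp_character irrW ineq Th To Tc i hX).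
Qed.
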